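(* Let $d\ge2$, let $Y_1,\ldots,Y_n$ be (possibly dependent) random vectors in $\mathbb{R}^d$ that are almost surely in type $A$ general position, and let $\mathcal{D}_n^A$ be the Weyl random cone of type $A_{n-1}$. Then, for all $1\le j\le k\le d$, $$\mathbb{E}\, Y_{d-k+j,\,d-k}(\mathcal{D}_n^A)=\frac{\binom{n-1}{k-j}D^A(n-k+j,j)}{2D^A(n,d)}\cdot\frac{n!}{(n-k+j)!}.$$
   Context: Type $A$ general position: vectors $y_1,\ldots,y_n\in\mathbb{R}^d$ are said to be in type $A$ general position if $n\ge d+1$ and, for every permutation $\sigma$ of $\{1,\ldots,n\}$, any $d$ of the vectors $y_{\sigma(1)}-y_{\sigma(2)},\ldots,y_{\sigma(n-1)}-y_{\sigma(n)}$ are linearly independent. For $x\in\mathbb{R}^d\setminus\{0\}$ let $x^\perp=\{v\in\mathbb{R}^d:\langle v,x\rangle=0\}$. The Weyl tessellation $\mathcal{W}^A(y_1,\ldots,y_n)$ of type $A_{n-1}$ is the set of cones obtained as closures of the connected components of $\mathbb{R}^d\setminus\bigcup_{1\le i<j\le n}(y_i-y_j)^\perp$. The Weyl random cone $\mathcal{D}_n^A$ is obtained by choosing uniformly at random one of the cones of the random tessellation $\mathcal{W}^A(Y_1,\ldots,Y_n)$; that is, for a functional $\varphi$ of cones, $\mathbb{E}\varphi(\mathcal{D}_n^A)=\mathbb{E}\big[\frac{1}{\#\mathcal{W}^A(Y_1,\ldots,Y_n)}\sum_{C\in\mathcal{W}^A(Y_1,\ldots,Y_n)}\varphi(C)\big]$.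 For a polyhedral cone $C\subset\mathbb{R}^d$, $\mathcal{F}_k(C)$ is the set of its $k$-dimensional faces, where faces are obtained by replacing some (possibly none) of the half-spaces defining $C$ by their boundaries. For a cone $C\subseteq\mathbb{R}^d$ that is not a linear subspace (the only case that occurs here) the conical quermassintegrals are $$U_j(C)=\frac12\int_{G(d,d-j)}\mathbf{1}\{C\cap L\ne\{0\}\}\,\nu_{d-j}(\mathrm{d}L),\quad j=0,\ldots,d,$$ where $G(d,m)$ is the Grassmannian of $m$-dimensional linear subspaces of $\mathbb{R}^d$ and $\nu_m$ is the unique rotation-invariant Borel probability measure on it. The size functionals (not to be confused with the random vectors $Y_i$) are $Y_{k,j}(C):=\sum_{F\in\mathcal{F}_k(C)}U_j(F)$ for $0\le j<k\le d$. The Stirling numbers of the first kind are defined by $t(t+1)\cdots(t+n-1)=\sum_{k=1}^n\genfrac{[}{]}{0pt}{}{n}{k}t^k$, with $\genfrac{[}{]}{0pt}{}{n}{k}=0$ for $k\notin\{1,\ldots,n\}$, and $D^A(m,k):=2\sum_{i\ge 0}\genfrac{[}{]}{0pt}{}{m}{m-k+1+2i}$. *)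

(* Defs.v *)
From HB Require Import structures.
From mathcomp Require Import all_boot all_order all_fingroup all_algebra finmap.
From mathcomp Require Import all_classical all_reals all_analysis.
Set Implicit Arguments.
Unset Strict Implicit.
Unset Printing Implicit Defensive.
Import Order.TTheory GRing.Theory Num.Theory.
Import numFieldNormedType.Exports.
Local Open Scope classical_set_scope.
Local Open Scope ring_scope.

Definition inner (R : realType) (d : nat) (u v : 'rV[R]_d) : R :=
  \sum_(c < d) u 0 c * v 0 c.

Definition perp (R : realType) (d : nat) (x : 'rV[R]_d) : set 'rV[R]_d :=
  [set v | inner v x = 0].

Definition halfspace (R : realType) (d : nat) (x : 'rV[R]_d) : set 'rV[R]_d :=
  [set v | inner v x <= 0].

(* [ordS i] has value [i.+1] when [i.+1 < n]; the cyclic index [i = n.-1] is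
   excluded by the condition on [I]. *)
Definition typeA_general_position (R : realType) (d n : nat)
    (y : 'I_n -> 'rV[R]_d) : Prop :=
  (d.+1 <= n)%N /\
  forall (s : 'S_n) (I : {set 'I_n}),
    (forall i, i \in I -> (i.+1 < n)%N) -> #|I| = d ->
    free [seq y (s i) - y (s (ordS i)) | i <- enum I].

Definition weyl_complement (R : realType) (d n : nat) (y : 'I_n -> 'rV[R]_d) :
    set 'rV[R]_d :=
  ~` \bigcup_(p in [set p : 'I_n * 'I_n | (p.1 < p.2)%N]) perp (y p.1 - y p.2).

Definition weyl_tessellation (R : realType) (d n : nat)
    (y : 'I_n -> 'rV[R]_d) : set (set 'rV[R]_d) :=
  [set closure (connected_component (weyl_complement y) v)
     | v in weyl_complement y].

(* The faces do not depend on the system of half-spaces representing [C], so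
   the representation is quantified existentially. *)
Definition is_face (R : realType) (d : nat) (C F : set 'rV[R]_d) : Prop :=
  exists (m : nat) (x : 'I_m -> 'rV[R]_d) (I : {set 'I_m}),
    [/\ forall i, x i != 0,
        C = \bigcap_(i in [set: 'I_m]) halfspace (x i) &
        F = \bigcap_(i in [set: 'I_m])
              (if i \in I then perp (x i) else halfspace (x i))].

(* The dimension of a cone is that of its linear hull, i.e. of the least
   subspace containing it. *)
Definition has_dim (R : realType) (d : nat) (F : set 'rV[R]_d) (k : nat) :
    Prop :=
  exists L : {vspace 'rV[R]_d},
    [/\ F `<=` [set` L],
        forall L' : {vspace 'rV[R]_d}, F `<=` [set` L'] -> (L <= L')%VS &
        \dim L = k].

Definition faces (R : realType) (d : nat) (k : nat) (C : set 'rV[R]_d) :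
    set (set 'rV[R]_d) :=
  [set F | is_face C F /\ has_dim F k].

HB.instance Definition _ (R : realType) (d : nat) :=
  isPointed.Build {vspace 'rV[R]_d} 0%VS.

(* All the Grassmannians G(d, m) of R^d are handled at once, on the type of
   linear subspaces of R^d topologized as their disjoint union.  A set of
   m-dimensional subspaces is open iff the m x d matrices of rank m whose row
   space lies in it form an open set: this is the quotient topology of
   G(d, m) = {rank-m matrices} / GL_m. *)
Definition row_space (R : realType) (d m : nat) (M : 'M[R]_(m, d)) :
    {vspace 'rV[R]_d} :=
  <<[seq row i M | i <- enum 'I_m]>>%VS.

Definition open_subspaces (R : realType) (d : nat) :
    set (set {vspace 'rV[R]_d}) :=
  [set A | forall m : nat,
     open [set M : 'M[R]_(m, d) | row_free M /\ A (row_space M)]].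

Definition subspaces (R : realType) (d : nat) : Type :=
  g_sigma_algebraType (@open_subspaces R d).

HB.instance Definition _ (R : realType) (d : nat) :=
  Measurable.on (subspaces R d).

Definition grassmannian (R : realType) (d m : nat) : set (subspaces R d) :=
  [set L : {vspace 'rV[R]_d} | \dim L = m].

Definition rotate (R : realType) (d : nat) (Q : 'M[R]_d)
    (L : {vspace 'rV[R]_d}) : {vspace 'rV[R]_d} :=
  (linfun (mulmxr Q : 'rV[R]_d -> 'rV[R]_d) @: L)%VS.

(* [nu] is carried by G(d, m) and invariant under SO(d). *)
Definition grassmann_measure (R : realType) (d m : nat)
    (nu : probability (subspaces R d) R) : Prop :=
  nu (@grassmannian R d m) = 1%E /\
  forall Q : 'M[R]_d, Q *m Q^T = 1%:M -> \det Q = 1 ->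
    forall A : set (subspaces R d), measurable A ->
      nu [set L | A (rotate Q L)] = nu A.

(* [nu m] is meant to be the invariant measure [grassmann_measure m (nu m)] for
   m <= d (G(d, m) is empty for m > d).  The formula is the one for cones that
   are not linear subspaces. *)
Definition quermassintegral (R : realType) (d : nat)
    (nu : nat -> probability (subspaces R d) R) (j : nat)
    (C : set 'rV[R]_d) : R :=
  2^-1 * \int[nu (d - j)%N]_(L in @grassmannian R d (d - j))
           \1_[set L : {vspace 'rV[R]_d} | C `&` [set` L] != [set 0]] L.

Definition size_functional (R : realType) (d : nat)
    (nu : nat -> probability (subspaces R d) R) (k j : nat)
    (C : set 'rV[R]_d) : R :=
  \sum_(F \in faces k C) quermassintegral nu j F.

Definition uniform_mean (R : realType) (d : nat) (W : set (set 'rV[R]_d))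
    (phi : set 'rV[R]_d -> R) : R :=
  (#|` fset_set W|%:R)^-1 * \sum_(C \in W) phi C.

Definition weyl_cone_expectation (R : realType) (dsp : measure_display)
    (Omega : measurableType dsp) (P : probability Omega R) (d n : nat)
    (Y : 'I_n -> Omega -> 'rV[R]_d) (phi : set 'rV[R]_d -> R) : \bar R :=
  ('E_P[fun w => uniform_mean (weyl_tessellation (fun i => Y i w)) phi])%E.

Definition stirling1 (n k : nat) : nat :=
  if (0 < k <= n)%N then (\prod_(i < n) ('X + i%:R) : {poly nat})`_k else 0%N.

(* D^A(m, k); the terms with i >= k vanish, and if m - k + 1 + 2i <= 0 then the
   truncated index is 0, at which [stirling1] vanishes as well. *)
Definition DA (m k : nat) : nat :=
  (2 * \sum_(i < k) stirling1 m (m + 1 + 2 * i - k))%N.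

(* Main.v *)
Require Import Defs.
From HB Require Import structures.
From mathcomp Require Import all_boot all_order all_fingroup all_algebra finmap.
From mathcomp Require Import all_classical all_reals all_analysis.
From mathcomp Require Import measurable_realfun zify lra ring.
Set Implicit Arguments.
Unset Strict Implicit.
Unset Printing Implicit Defensive.
Import Order.TTheory GRing.Theory Num.Theory.
Import numFieldNormedType.Exports.
Local Open Scope classical_set_scope.
Local Open Scope ring_scope.

(** The cones of the tessellation are the chambers of the arrangement of the
    hyperplanes orthogonal to the differences [y a - y b]; two vectors lie in the
    same chamber when they induce the same order on the points, through their
    inner products with them.  More generally the faces of the chambers
    correspond to the weak orders of the points induced by vectors, and a face
    belongs to a chamber when the order of the chamber refines the weak order of
    the face ([weyl_tessellationE], [faces_chamberE]).

    For points in general position, the number of orders realized by the vectors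
    of a [j]-dimensional subspace only depends on [j] and on the number [N] of
    points.  Removing a point and applying deletion-restriction to the hyperplanes
    that compare it to the others gives the recursion
    [DA N.+1 j.+1 = DA N j.+1 + N * DA N j] ([nchambers_braid], [card_realized]).
    In particular the tessellation has [DA n d] cones.

    Write [m = k - j] and [N = n - m].  The size functional of a chamber sums over
    its faces of codimension [m], which are the weak orders with [N] levels, one
    half of the probability that a random [k]-dimensional subspace [L] meets the
    face outside of [0].  So the sum over all chambers is half of the expected
    number of incident triples made of a chamber, a face of it and [L] meeting
    this face.  This number is almost surely constant.  Indeed, [L] is almost
    surely in general position with respect to the points, and then it meets a
    face exactly when it contains a vector inducing the weak order of this face.
    Permuting the [N] levels of a weak order acts on the pairs of a weak order
    and a refinement of it; there are [n! * 'C(n - 1, N - 1)] such pairs, as a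
    weak order coarser than a given order is a choice of [N - 1] cuts; and among
    the [N!] relabellings of the levels, those realized in [L] are the orders of
    [N] points realized in a subspace of [L] of dimension [j], hence [DA N j] of
    them ([card_good_pairs], [card_real_relabel]).  The number of incidences is
    therefore [n! / N! * 'C(n - 1, N - 1) * DA N j], and dividing by twice the
    number of chambers gives the formula.

    That a random subspace is almost surely in general position is derived from
    the invariance under rotations alone ([hitV_null]): if [L] met with positive
    probability a fixed subspace of complementary dimension, it would meet with
    the same probability arbitrarily many images of it, chosen so that no [L]
    can meet more than a bounded number of them. *)

(** * Orthogonality *)

Section Inner.
Variables (R : realType) (d : nat).
Implicit Types (u v w x y : 'rV[R]_d).

Lemma innerE u v : inner u v = (u *m v^T) 0 0.
Proof. by rewrite mxE; apply: eq_bigr => i _; rewrite mxE. Qed.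

Lemma innerC u v : inner u v = inner v u.
Proof. by apply: eq_bigr => i _; rewrite mulrC. Qed.

Lemma innerDl u v w : inner (u + v) w = inner u w + inner v w.
Proof. by rewrite !innerE mulmxDl mxE. Qed.

Lemma innerZl a u w : inner (a *: u) w = a * inner u w.
Proof. by rewrite !innerE -scalemxAl mxE. Qed.

Lemma innerNl u w : inner (- u) w = - inner u w.
Proof. by rewrite -scaleN1r innerZl mulN1r. Qed.

Lemma innerBl u v w : inner (u - v) w = inner u w - inner v w.
Proof. by rewrite innerDl innerNl. Qed.

Lemma innerBr u v w : inner u (v - w) = inner u v - inner u w.
Proof. by rewrite ![inner u _]innerC innerBl. Qed.

Lemma inner0l u : inner 0 u = 0.
Proof. by rewrite -(scale0r 0) innerZl mul0r. Qed.

Lemma inner_sq_eq0 u : (inner u u == 0) = (u == 0).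
Proof.
rewrite /inner psumr_eq0 => [|i _]; last by rewrite -expr2 sqr_ge0.
apply/allP/eqP => [u0|-> i _]; last by rewrite mxE mulr0 eqxx.
apply/rowP => i; rewrite mxE; apply/eqP.
by have := u0 i (mem_index_enum i); rewrite mulf_eq0 orbb.
Qed.

Definition hyp x : {vspace 'rV[R]_d} :=
  lker (linfun (mulmxr x^T : 'rV[R]_d -> 'M[R]_(1, 1))).

Lemma mem_hyp v x : (v \in hyp x) = (inner v x == 0).
Proof.
rewrite memv_ker lfunE /= innerE; apply/eqP/eqP => [->|h]; first by rewrite mxE.
by apply/matrixP => i j; rewrite !ord1 h mxE.
Qed.

Lemma dim_cap_hyp (U : {vspace 'rV[R]_d}) x :
  (\dim U <= (\dim (U :&: hyp x)).+1)%N.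
Proof.
have := limg_ker_dim (linfun (mulmxr x^T : 'rV[R]_d -> 'M[R]_(1, 1))) U.
set f := linfun _; have : (\dim (f @: U) <= 1)%N.
  by rewrite (leq_trans (dimvS (subvf _)))// dimvf dim_matrix.
by move=> f1 <-; rewrite -[X in (_ <= X)%N]addn1 leq_add2l.
Qed.

Lemma dim_cap_hyps (U : {vspace 'rV[R]_d}) (s : seq 'rV[R]_d) :
  (\dim U <= \dim (U :&: \bigcap_(x <- s) hyp x)%VS + size s)%N.
Proof.
elim: s U => [|x s IH] U; first by rewrite big_nil capvf addn0.
rewrite big_cons capvA /= addnS.
by apply: (leq_trans (dim_cap_hyp U x)); rewrite ltnS.
Qed.

Lemma dimv_rV : \dim {: 'rV[R]_d} = d.
Proof. by rewrite dimvf dim_matrix; exact: mul1n. Qed.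

Lemma cap_hyps_free (s : seq 'rV[R]_d) : free s -> size s = d ->
  (\bigcap_(x <- s) hyp x)%VS = 0%VS.
Proof.
move=> fs sd; apply/eqP; rewrite -subv0; apply/subvP => v vs.
have sF : span s = fullv.
  by apply/eqP; rewrite eqEdim subvf /= (eqP fs) sd dimv_rV.
have vv : forall x, x \in s -> inner x v = 0.
  move=> x xs; apply/eqP; rewrite innerC -mem_hyp.
  by apply: subvP (v) vs; rewrite (big_rem x)//= capvSl.
suff : inner v v = 0 by move/eqP; rewrite inner_sq_eq0 => /eqP ->; rewrite mem0v.
have : v \in span (in_tuple s) by rewrite sF memvf.
move/coord_span => {1}->.
have inner_sum (I : finType) (F : I -> 'rV[R]_d) : inner (\sum_i F i) v = \sum_i inner (F i) v.
  by elim/big_rec2: _ => [|i a b _ <-]; rewrite ?inner0l ?innerDl.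
rewrite inner_sum big1// => i _.
by rewrite innerZl vv ?mulr0// mem_nth.
Qed.

End Inner.

(** * Partitions and rankings of the points *)

(** Partitions of the points are given by labellings, with values in any type:
    ranks, inner products with a vector, pairs of these. *)
Definition nblocks (n : nat) (T : eqType) (p : 'I_n -> T) : nat :=
  size (undup (codom p)).

Section Blocks.
Variable n : nat.
Implicit Types (T S : eqType).

Lemma nblocks_le T (p : 'I_n -> T) : (nblocks p <= n)%N.
Proof. by rewrite (leq_trans (size_undup _))// size_codom card_ord. Qed.

Lemma nblocks_comp T S (q : 'I_n -> T) (f : T -> S) :
  nblocks (f \o q) = size (undup (map f (undup (codom q)))).
Proof.
apply/perm_size/uniq_perm; rewrite ?undup_uniq// => x; rewrite !mem_undup.
have -> : codom (f \o q) = map f (codom q) by rewrite !codomE -map_comp.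
by apply/mapP/mapP => -[y yq ->]; exists y; rewrite // ?mem_undup// -mem_undup.
Qed.

Lemma nblocks_comp_inj T S (q : 'I_n -> T) (f : T -> S) :
  {in codom q &, injective f} -> nblocks (f \o q) = nblocks q.
Proof.
move=> fI; rewrite nblocks_comp undup_id ?size_map// map_inj_in_uniq ?undup_uniq//.
by move=> a b; rewrite !mem_undup; apply: fI.
Qed.

Lemma nblocks_comp_lt T S (q : 'I_n -> T) (f : T -> S) a b :
  q a != q b -> f (q a) = f (q b) -> (nblocks (f \o q) < nblocks q)%N.
Proof.
move=> ab fab; rewrite nblocks_comp /nblocks -(size_map f (undup (codom q))).
rewrite ltn_size_undup; apply/negP => uf.
have im c : q c \in undup (codom q) by rewrite mem_undup codom_f.
have := uniqP (f (q a)) uf; set s := [seq _ | _ <- _] => /(_ (index (q a) (undup (codom q))) (index (q b) (undup (codom q)))).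
rewrite !inE !size_map !index_mem !im => /(_ isT isT).
rewrite /s !(nth_map (q a)) ?index_mem ?im// !nth_index ?im// => /(_ fab) ii.
by move: ab; rewrite -[q a](nth_index (q a) (im a)) ii nth_index ?im// eqxx.
Qed.

(** General position is stated below for labellings of the points by points;
    this extends it to labellings with values in any type. *)
Lemma ord_labelling T (p : 'I_n -> T) : exists q : 'I_n -> 'I_n,
  (forall a b, (q a == q b) = (p a == p b)) /\ nblocks q = nblocks p.
Proof.
have im c : p c \in codom p by rewrite codom_f.
have sz c : (index (p c) (codom p) < n)%N.
  by have := im c; rewrite -index_mem size_codom card_ord.
exists (fun c => Ordinal (sz c)).
have E a b : (Ordinal (sz a) == Ordinal (sz b)) = (p a == p b).
  rewrite -val_eqE /=; apply/eqP/eqP => [h|->//].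
  by rewrite -[p a](nth_index (p a) (im a)) h nth_index.
split=> //.
rewrite -(@nblocks_comp_inj _ _ (fun c => Ordinal (sz c)) val); last first.
  by move=> x y _ _; apply: val_inj.
rewrite -(@nblocks_comp_inj _ _ p (fun x => index x (codom p)))//.
by move=> x y xp yp h; rewrite -[x](nth_index x xp) h nth_index.
Qed.

End Blocks.

Section Ranking.
Variable n : nat.

(** Weak orders with [N] levels are encoded by maps onto ['I_N], the level of a
    point being the rank of its value among the distinct values. *)
Lemma ranking dsp (T : orderType dsp) (f : 'I_n -> T) (N : nat) :
  nblocks f = N ->
  exists p : 'I_n -> 'I_N, (forall a b, (p a <= p b)%N = (f a <= f b)%O) /\
    (forall c, exists a, p a = c).
Proof.
move=> fN; pose L := sort <=%O (undup (codom f)).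
have sL : size L = N by rewrite size_sort.
have fL a : f a \in L by rewrite mem_sort mem_undup codom_f.
have ltL : sorted <%O L by rewrite sort_lt_sorted undup_uniq.
have iL a : (index (f a) L < N)%N by rewrite -sL index_mem.
exists (fun a => Ordinal (iL a)); split => [a b|c].
  by rewrite /= -(lt_sorted_leq_nth (f a) ltL) ?inE ?index_mem// !nth_index.
have cL : (c < size L)%N by rewrite sL.
have [x0 _] : exists x0, x0 \in L.
  by case: L cL {sL fL ltL iL} => [//|x l _]; exists x; rewrite mem_head.
have := mem_nth x0 cL; rewrite mem_sort mem_undup => /codomP[a ca].
exists a; apply: val_inj => /=.
by rewrite -ca index_uniq// sort_uniq undup_uniq.
Qed.

Lemma nblocks_inj (T : eqType) (f : 'I_n -> T) : injective f -> nblocks f = n.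
Proof.
move=> fI; rewrite /nblocks undup_id ?size_codom ?card_ord//.
by rewrite codomE map_inj_uniq// enum_uniq.
Qed.

Lemma perm_ranking dsp (T : orderType dsp) (f : 'I_n -> T) : injective f ->
  exists p : 'S_n, forall a b, (p a <= p b)%N = (f a <= f b)%O.
Proof.
move=> fI; have [p [pf _]] := ranking (nblocks_inj fI).
have pI : injective p.
  by move=> a b ab; apply: fI; apply/le_anti; rewrite -!pf ab leqnn.
by exists (perm pI) => a b; rewrite !permE.
Qed.

Lemma nblocks_card (m : nat) (p : 'I_n -> 'I_m) : nblocks p = #|[set p a | a : 'I_n]%SET|.
Proof.
rewrite /nblocks cardE; apply/perm_size/uniq_perm; rewrite ?undup_uniq ?enum_uniq//.
move=> x; rewrite mem_undup mem_enum; apply/codomP/imsetP => [[a ->]|[a _ ->]].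
  by exists a.
by exists a.
Qed.

Lemma nblocks_onto (m : nat) (p : 'I_n -> 'I_m) :
  (forall c, exists a, p a = c) -> nblocks p = m.
Proof.
move=> ps; rewrite nblocks_card -[RHS]card_ord -cardsT; congr #|pred_of_set _|.
apply/setP => c; rewrite inE; apply/imsetP.
by have [a <-] := ps c; exists a.
Qed.

End Ranking.

Lemma set_between (T : finType) (A B : {set T}) k :
  A \subset B -> (#|A| <= k <= #|B|)%N ->
  exists C : {set T}, [/\ A \subset C, C \subset B & #|C| = k].
Proof.
move=> AB /andP[Ak kB].
pose D := [set x in take (k - #|A|) (enum (B :\: A)%SET)]%SET.
have DBA : D \subset (B :\: A)%SET.
  by apply/fintype.subsetP => x; rewrite inE => /mem_take; rewrite mem_enum.
have cD : #|D| = (k - #|A|)%N.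
  rewrite cardsE (card_uniqP _) ?take_uniq ?enum_uniq// size_take_min -cardE.
  by rewrite cardsD (finset.setIidPr AB); lia.
exists (A :|: D)%SET; split.
- exact: finset.subsetUl.
- by rewrite finset.subUset AB (fintype.subset_trans DBA)// finset.subsetDl.
- rewrite cardsU cD; have -> : (A :&: D)%SET = finset.set0.
    apply/setP => x; rewrite !inE; apply/negP => /andP[xA xD].
    by have := fintype.subsetP DBA x; rewrite !inE xD xA => /(_ isT).
  by rewrite cards0; lia.
Qed.

(** The source of all perturbation arguments: finitely many strict
    inequalities survive a small enough change. *)
Lemma small_scale (R : realType) (I : finType) (f g : I -> R) :
  (forall i, 0 < f i) -> exists2 e, 0 < e & forall i, `|e * g i| < f i.
Proof.
move=> f0; pose S := \sum_i `|g i| / f i.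
have gf0 i : 0 <= `|g i| / f i by rewrite divr_ge0// ltW.
have S0 : 0 <= S by apply: sumr_ge0.
exists (1 + S)^-1 => [|i]; first by rewrite invr_gt0 ltr_pwDl.
rewrite normrM gtr0_norm ?invr_gt0 ?ltr_pwDl// mulrC ltr_pdivrMr ?ltr_pwDl//.
rewrite -ltr_pdivrMl// mulrC (@le_lt_trans _ _ S)// ?ltrDr//.
by rewrite /S (bigD1 i)//= lerDl sumr_ge0.
Qed.

(** * General position *)

Section Ties.
Variables (R : realType) (d n : nat).
Implicit Types (y : 'I_n -> 'rV[R]_d) (V : {vspace 'rV[R]_d}).

Definition ties y (T : eqType) (p : 'I_n -> T) : {vspace 'rV[R]_d} :=
  (\bigcap_(ab : 'I_n * 'I_n | p ab.1 == p ab.2) hyp (y ab.1 - y ab.2))%VS.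

Lemma mem_bigcap (I : finType) (P : pred I) (U : I -> {vspace 'rV[R]_d}) v :
  reflect (forall i, P i -> v \in U i) (v \in \bigcap_(i | P i) U i)%VS.
Proof.
rewrite memvE; apply: (iffP subv_bigcapP) => h i Pi.
  by rewrite memvE h.
by rewrite -memvE h.
Qed.

Lemma tiesP y (T : eqType) (p : 'I_n -> T) v :
  reflect (forall a b, p a = p b -> inner v (y a) = inner v (y b)) (v \in ties y p).
Proof.
apply: (iffP (mem_bigcap _ _ _)) => [h a b /eqP ab|h [a b]/= /eqP ab].
  by have := h (a, b) ab; rewrite mem_hyp innerBr subr_eq0 => /eqP.
by rewrite mem_hyp innerBr subr_eq0 (h _ _ ab).
Qed.

Lemma eq_ties y (T S : eqType) (p : 'I_n -> T) (q : 'I_n -> S) :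
  (forall a b, (p a == p b) = (q a == q b)) -> ties y p = ties y q.
Proof. by move=> pq; apply: eq_bigl => -[a b]. Qed.

(** Identifying the points of a block costs one dimension for each point but
    one, until nothing is left: the subtraction is truncated on purpose.  Unlike
    the condition along permutations, this form passes to generic subspaces, to
    subsets of the points, and to hyperplanes where two points agree. *)
Definition in_general_position V y := forall p : 'I_n -> 'I_n,
  \dim (V :&: ties y p) = (\dim V - (n - nblocks p))%N.

Lemma gp_dim V y (T : eqType) (p : 'I_n -> T) : in_general_position V y ->
  \dim (V :&: ties y p) = (\dim V - (n - nblocks p))%N.
Proof.
have [q [qp qn]] := ord_labelling p.
by move=> /(_ q); rewrite qn (eq_ties y qp).
Qed.

Lemma perturb_lt y v u : exists2 e, 0 < e & forall a b,
  inner v (y a) < inner v (y b) -> inner (v + e *: u) (y a) < inner (v + e *: u) (y b).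
Proof.
pose gap (ab : 'I_n * 'I_n) := if inner v (y ab.1) < inner v (y ab.2)
  then inner v (y ab.2) - inner v (y ab.1) else 1.
have gap0 ab : 0 < gap ab by rewrite /gap; case: ifP => //; rewrite subr_gt0.
have [e e0 he] := small_scale (fun ab => inner u (y ab.1) - inner u (y ab.2)) gap0.
exists e => // a b ab; have := he (a, b).
by rewrite /gap /= ab !innerDl !innerZl mulrBr ltr_norml => /andP[_]; lra.
Qed.

(** A weak order refining the one of a nonzero vector of [V] is realized in [V].
    The superfluous ties of [v] are separated one after the other: splitting one
    block in two raises the dimension of the space of vectors with these ties,
    as it was positive because of [v] itself, so some vector [u] separates the
    two halves and nothing else, and a small multiple of [u] is added to [v]. *)
Lemma realize_refinement V y (v : 'rV[R]_d) (s : 'I_n -> nat) :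
  in_general_position V y -> v \in V -> v != 0 ->
  (forall a b, (s a <= s b)%N -> inner v (y a) <= inner v (y b)) ->
  exists2 u, u \in V & forall a b, (inner u (y a) <= inner u (y b)) = (s a <= s b)%N.
Proof.
move=> gp; pose bad v := [set ab : 'I_n * 'I_n |
  (s ab.1 < s ab.2)%N && (inner v (y ab.1) == inner v (y ab.2))]%SET.
have [m] := ubnP #|bad v|; elim: m v => // m IH v + vV v0 vs.
have [bv _|[[a0 b0]]] := set_0Vmem (bad v).
  exists v => // a b; apply/idP/idP; last exact: vs.
  apply: contraTT; rewrite -ltnNge -ltNge => ba.
  rewrite lt_neqAle vs ?(ltnW ba)// andbT; apply/negP => ab.
  have : (b, a) \in bad v by rewrite inE /= ba ab.
  by rewrite bv inE.
rewrite inE /= => /andP[sab /eqP vab] cv.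
(* The block of [v] containing [a0] and [b0] is cut just above the level of [a0]. *)
pose p c := (inner v (y c), (inner v (y c) == inner v (y a0)) && (s a0 < s c)%N).
have pn : (nblocks (fun c => inner v (y c)) < nblocks p)%N.
  have pab : p a0 != p b0 by rewrite /p vab eqxx sab ltnn xpair_eqE eqxx.
  by have := nblocks_comp_lt (f := fst) pab; apply.
have vt : v \in (V :&: ties y (fun c => inner v (y c)))%VS.
  by rewrite memv_cap vV; apply/tiesP.
have vd : (0 < \dim (V :&: ties y (fun c => inner v (y c))))%N.
  rewrite lt0n dimv_eq0; apply/eqP => h; move: vt; rewrite h memv0 => /eqP v00.
  by rewrite v00 eqxx in v0.
have dlt : (\dim (V :&: ties y (fun c => inner v (y c))) < \dim (V :&: ties y p))%N.
  move: vd; rewrite !gp_dim//; have := nblocks_le p; lia.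
have [u uVp uN] : exists2 u, u \in (V :&: ties y p)%VS & inner u (y a0) < inner u (y b0).
  have /subvPn[u uVp uN] : ~~ (V :&: ties y p <= V :&: ties y (fun c => inner v (y c)))%VS.
    by apply/negP => /dimvS; rewrite leqNgt dlt.
  have neq : inner u (y a0) != inner u (y b0).
    apply: contraNneq uN => uab.
    move: (uVp); rewrite !memv_cap => /andP[-> /tiesP up] /=.
    apply/tiesP => a b ab.
    have half c : inner v (y c) = inner v (y a0) -> inner u (y c) = inner u (y a0).
      move=> vc; case: (boolP (s a0 < s c)%N) => sc.
        by rewrite uab; apply: up; rewrite /p vc vab eqxx sc sab.
      by apply: up; rewrite /p vc eqxx (negPf sc) ltnn.
    have [va|va] := eqVneq (inner v (y a)) (inner v (y a0)).
      by rewrite !half// -ab.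
    by apply: up; rewrite /p -ab (negPf va).
  move: neq; rewrite neq_lt => /orP[|] h; first by exists u.
  by exists (- u); rewrite ?memvN// !innerNl ltrN2.
move: uVp; rewrite memv_cap => /andP[uV /tiesP up].
have [e e0 wlt] := perturb_lt y v u.
pose w := v + e *: u.
have wE a : inner w (y a) = inner v (y a) + e * inner u (y a) by rewrite innerDl innerZl.
have wle a b : (s a <= s b)%N -> inner w (y a) <= inner w (y b).
  move=> ab; have := vs _ _ ab; rewrite le_eqVlt => /orP[/eqP vv|/wlt/ltW//].
  rewrite !wE vv lerD2l ler_pM2l//.
  have [va|va] := eqVneq (inner v (y b)) (inner v (y a0)); last first.
    by rewrite (up a b)// /p vv (negPf va).
  have [sa|sa] := boolP (s a0 < s a)%N.
    by rewrite (up a b)// /p vv va eqxx sa (leq_trans sa ab).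
  have [sb|sb] := boolP (s a0 < s b)%N.
    rewrite (up a a0); last by rewrite /p vv va eqxx (negPf sa) ltnn.
    by rewrite (up b b0) ?ltW// /p va vab eqxx sb sab.
  by rewrite (up a b)// /p vv va eqxx (negPf sa) (negPf sb).
apply: (IH w) => //.
- rewrite ltnS in cv; apply: (leq_trans _ cv); apply: proper_card.
  apply/fintype.properP; split.
    apply/fintype.subsetP => -[a b]; rewrite !inE /= => /andP[ab /eqP h]; rewrite ab /=.
    have := vs _ _ (ltnW ab); rewrite le_eqVlt => /orP[//|/wlt].
    by rewrite h ltxx.
  exists (a0, b0); first by rewrite inE /= sab vab eqxx.
  rewrite inE /= sab /= !wE vab; apply/eqP => /addrI/(mulfI (lt0r_neq0 e0)) h.
  by rewrite h ltxx in uN.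
- by apply: memvD => //; apply: memvZ.
- apply/eqP => w0; have := wE a0; have := wE b0; rewrite w0 !inner0l vab => h1 h2.
  have := uN; rewrite -(ltr_pM2l e0); lra.
Qed.

End Ties.

Lemma dim_cap_hyps_set (R : realType) (d : nat) (I : finType) (A : {set I})
    (x : I -> 'rV[R]_d) (U : {vspace 'rV[R]_d}) :
  (\dim U <= \dim (U :&: \bigcap_(i in A) hyp (x i))%VS + #|A|)%N.
Proof.
have := dim_cap_hyps U [seq x i | i <- enum A].
by rewrite big_map big_enum size_map -cardE.
Qed.

(** The definition of general position only constrains consecutive differences
    along permutations.  A partition is reached by a permutation listing its
    blocks one after the other: taking equal values on each block then amounts
    to being orthogonal to [n - nblocks p] consecutive differences. *)
Lemma typeA_in_general_position (R : realType) (d n : nat) (y : 'I_n -> 'rV[R]_d) :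
  typeA_general_position y -> in_general_position fullv y.
Proof.
move=> [dn yfree] p; rewrite capfv dimv_rV.
(* Ordering the points by block, and by index inside a block. *)
have keyI : injective (fun a : 'I_n => (p a * n + a)%N).
  move=> a b ab; have n0 : (0 < n)%N by rewrite (leq_ltn_trans _ (ltn_ord a)).
  apply: val_inj; have := congr1 (modn^~ n) ab.
  by rewrite !modnMDl !modn_small.
have [r rE] := perm_ranking keyI.
pose s := (r^-1)%g.
have smono (i j : 'I_n) : (i <= j)%N -> (p (s i) <= p (s j))%N.
  rewrite -{1}[i](permKV r) -{1}[j](permKV r) rE /= => h.
  rewrite leqNgt; apply/negP => h'.
  have := ltn_ord (s i); have := ltn_ord (s j); rewrite /s in h' *; nia.
have n0 : (0 < n)%N by lia.
pose W := [set i : 'I_n | (i.+1 < n)%N]%SET.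
pose x (i : 'I_n) := y (s i) - y (s (ordS i)).
have ordSE (i : 'I_n) : i \in W -> ordS i = i.+1 :> nat by rewrite inE /= => h; rewrite modn_small.
(* [I0] is the set of positions where the listing stays in the same block. *)
pose I0 := [set i in W | p (s i) == p (s (ordS i))]%SET.
have cW : #|W| = n.-1.
  have lift_lt (i : 'I_n.-1) : (i < n)%N by have := ltn_ord i; lia.
  have -> : W = [set Ordinal (lift_lt i) | i : 'I_n.-1]%SET.
    apply/setP => i; rewrite inE; apply/idP/imsetP => [h|[k _ ->]/=].
      have h' : (i < n.-1)%N by lia.
      by exists (Ordinal h') => //; apply: val_inj.
    have := ltn_ord k; lia.
  by rewrite card_imset ?card_ord// => i j /(congr1 val) /= /val_inj.
have cI0 : (#|I0| + nblocks p = n)%N.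
  have -> : nblocks p = #|(~: I0)%SET|; last by rewrite cardsC card_ord.
  (* The last positions of the blocks correspond to the blocks. *)
  have const (i j : 'I_n) : (i < j)%N -> p (s i) = p (s j) -> i \in I0.
    move=> ij pij; have iW : i \in W by rewrite inE (leq_ltn_trans ij).
    rewrite inE iW /= -val_eqE eqn_leq smono ?ordSE//= pij smono// ordSE//.
  have cJ : #|[set (p \o s) i | i in (~: I0)%SET]%SET| = #|(~: I0)%SET|.
    apply: card_in_imset.
    move=> i j; rewrite !inE => iI jI /= pij; apply/val_inj/eqP; rewrite eqn_leq.
    apply/andP; split; rewrite leqNgt; apply/negP => h.
      by have := const _ _ h (esym pij); rewrite !inE (negPf jI).
    by have := const _ _ h pij; rewrite !inE (negPf iI).
  rewrite nblocks_card -cJ.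
  apply: eq_card => c; apply/imsetP/imsetP => [[a _ ->]|[a _ ->]]; last by exists (s a).
  pose Q i := p (s i) == p a.
  have Qra : Q (r a) by rewrite /Q /s permK.
  case: (arg_maxnP (fun i : 'I_n => val i) Qra) => i /eqP Qi imax.
  exists i; last by rewrite /= Qi.
  rewrite !inE; apply/negP => /andP[iW /eqP pS].
  have := imax (ordS i); rewrite /Q -pS Qi eqxx => /(_ isT).
  by rewrite /= modn_small// ltnn.
have tiesE : ties y p = (\bigcap_(i in I0) hyp (x i))%VS.
  apply: subv_anti; apply/andP; split; apply/subvP => v.
    move=> /tiesP vp; apply/mem_bigcap => i; rewrite inE => /andP[_ /eqP /vp].
    by rewrite mem_hyp innerBr subr_eq0 => ->.
  move=> /mem_bigcap vI; apply/tiesP.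
  suff main k (i j : 'I_n) : (j = i + k :> nat)%N -> p (s i) = p (s j) ->
      inner v (y (s i)) = inner v (y (s j)).
    move=> a b; rewrite -[a](permK r) -[b](permK r) -/s.
    case: (leqP (r a) (r b)) => h ab; last apply/esym.
      by apply: (main (r b - r a)%N) => //; rewrite subnKC.
    by apply: (main (r a - r b)%N) => //; rewrite subnKC// ltnW.
  elim: k i => [|k IH] i ji pij.
    by congr (inner v (y (s _))); apply: val_inj; rewrite /= ji addn0.
  have iW : i \in W by rewrite inE; have := ltn_ord j; lia.
  have pS : p (s i) = p (s (ordS i)).
    have lei : (i <= ordS i)%N by rewrite ordSE.
    have lej : (ordS i <= j)%N by rewrite ordSE// ji; lia.
    by apply/val_inj/eqP; rewrite eqn_leq smono//= pij smono.
  rewrite -(IH (ordS i)) ?ordSE -?pS//; last by rewrite ji addnS addSn.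
  by apply/eqP; rewrite -subr_eq0 -innerBr -mem_hyp vI// inE iW pS eqxx.
have hyps0 (I : {set 'I_n}) : I \subset W -> #|I| = d ->
    (\bigcap_(i in I) hyp (x i))%VS = 0%VS.
  move=> IW cI; have := @cap_hyps_free _ _ [seq x i | i <- enum I].
  rewrite big_map big_enum size_map -cardE; apply => //; apply: yfree => // i.
  by move/(fintype.subsetP IW); rewrite inE.
have I0W : I0 \subset W by apply/fintype.subsetP => i; rewrite inE => /andP[].
have -> : (n - nblocks p = #|I0|)%N by lia.
have [dI|Id] := leqP d #|I0|.
  have d0 : (#|@finset.set0 'I_n| <= d <= #|I0|)%N by rewrite cards0.
  have [I [_ II0 cI]] := set_between (finset.sub0set I0) d0.
  have -> : (d - #|I0| = 0)%N by lia.
  apply/eqP; rewrite dimv_eq0 -subv0 -(hyps0 I) ?(fintype.subset_trans II0)// tiesE.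
  apply/subvP => v /mem_bigcap h; apply/mem_bigcap => i iI.
  by apply: h; apply: fintype.subsetP iI.
have dW : (#|I0| <= d <= #|W|)%N by rewrite cW ltnW//=; lia.
have [I [I0I IW cI]] := set_between I0W dW.
apply/eqP; rewrite eqn_leq; apply/andP; split; last first.
  have := dim_cap_hyps_set I0 x fullv; rewrite capfv dimv_rV -tiesE; lia.
have := dim_cap_hyps_set (I :\: I0)%SET x (ties y p).
have -> : (ties y p :&: \bigcap_(i in (I :\: I0)%SET) hyp (x i))%VS = 0%VS.
  apply/eqP; rewrite -subv0 -(hyps0 I)// tiesE; apply/subvP => v.
  rewrite memv_cap => /andP[/mem_bigcap h /mem_bigcap h']; apply/mem_bigcap => i iI.
  by case: (boolP (i \in I0)) => [/h//|iI0]; apply: h'; rewrite inE iI0.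
by rewrite dimv0 add0n cardsD (finset.setIidPr I0I) cI.
Qed.

(** * The recursion of the numbers DA *)

Section Stirling.

(** The product vanishes outside of the range in which [stirling1] reads it,
    except in degree [0] for an empty product. *)
Lemma stirling1E n k : (0 < n)%N ->
  stirling1 n k = (\prod_(i < n) ('X + i%:R) : {poly nat})`_k.
Proof.
move=> n0; rewrite /stirling1; case: ifP => // /negbT.
rewrite negb_and -leqNgt -ltnNge => /orP[|kn].
  rewrite leqn0 => /eqP ->; case: n n0 => // n _.
  by rewrite big_ord_recl addr0 coefXM.
have sz m : (size (\prod_(i < m) ('X + i%:R) : {poly nat})%R <= m.+1)%N.
  elim: m => [|m IH]; first by rewrite big_ord0 size_polyC oner_neq0.
  rewrite big_ord_recr /= (leq_trans (size_polyMleq _ _))//.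
  have : (size ('X + m%:R : {poly nat})%R <= 2)%N.
    rewrite (leq_trans (size_polyD _ _))// size_polyX geq_max /=.
    by rewrite -polyC_natr (leq_trans (size_polyC_leq1 _)).
  by move: (size _) (size _) IH => a b; lia.
by rewrite nth_default// (leq_trans (sz n)).
Qed.

Lemma stirling1_out n k : (n < k)%N -> stirling1 n k = 0%N.
Proof. by move=> nk; rewrite /stirling1 [(k <= n)%N]leqNgt nk andbF. Qed.

Lemma stirling1_0 n : stirling1 n 0 = 0%N.
Proof. by []. Qed.

Lemma stirling1S n k : (0 < n)%N ->
  stirling1 n.+1 k.+1 = (stirling1 n k + n * stirling1 n k.+1)%N.
Proof.
move=> n0; rewrite !stirling1E// big_ord_recr /= mulrDr coefD coefMX /=.
by rewrite -polyC_natr mulrC coefCM natn.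
Qed.

Lemma DA0 n : DA n 0 = 0%N.
Proof. by rewrite /DA big_ord0. Qed.

(** The recursion of the Stirling numbers splits each term into a term of
    [DA n k.+1] and [n] times a term of [DA n k]. *)
Lemma DA_rec n k : (0 < n)%N -> DA n.+1 k.+1 = (DA n k.+1 + n * DA n k)%N.
Proof.
move=> n0; rewrite /DA mulnCA -mulnDr; congr (2 * _)%N.
have -> : (\sum_(i < k) stirling1 n (n + 1 + 2 * i - k) =
           \sum_(i < k.+1) stirling1 n (n + 1 + 2 * i - k))%N.
  by rewrite big_ord_recr /= (stirling1_out (k := n + 1 + 2 * k - k)) ?addn0//; lia.
rewrite big_distrr -big_split /=; apply: eq_bigr => i _.
have [h|h] := leqP (n.+1 + 1 + 2 * i) k.+1.
  have [-> -> ->] : [/\ n.+1 + 1 + 2 * i - k.+1 = 0, n + 1 + 2 * i - k.+1 = 0 &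
    n + 1 + 2 * i - k = 0]%N by split; lia.
  by rewrite !stirling1_0 muln0.
have -> : (n.+1 + 1 + 2 * i - k.+1 = (n + 1 + 2 * i - k.+1).+1)%N by lia.
by rewrite stirling1S//; congr (_ + _ * stirling1 _ _)%N; lia.
Qed.

Lemma DA_2 k : DA 2 k.+1 = 2.
Proof.
have s11 : stirling1 1 1 = 1%N by rewrite stirling1E// big_ord1 addr0 coefX.
have s21 : stirling1 2 1 = 1%N by rewrite stirling1S// stirling1_0 s11.
have s22 : stirling1 2 2 = 1%N by rewrite stirling1S// s11 stirling1_out.
rewrite /DA -[RHS]muln1; congr (2 * _)%N.
have kk : (k./2 < k.+1)%N by rewrite ltnS leq_half_double; lia.
(* Consecutive indices differ by 2, so exactly one of them is 1 or 2. *)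
rewrite (bigD1 (Ordinal kk))//= big1 ?addn0 => [|i].
  have := odd_double_half k; case: odd => /= h.
    by have -> : (2 + 1 + 2 * k./2 - k.+1 = 1)%N by lia.
  by have -> : (2 + 1 + 2 * k./2 - k.+1 = 2)%N by lia.
rewrite -val_eqE /= => ik.
have := odd_double_half k; have [h|h] := leqP (2 + 1 + 2 * i) k.+1 => hk.
  by have -> : (2 + 1 + 2 * i - k.+1 = 0)%N by lia.
apply: stirling1_out; move: hk; case: odd => /=; lia.
Qed.

End Stirling.

(** * Counting chambers by deletion and restriction *)

Section DeletionRestriction.
Variables (R : realType) (d : nat).
Implicit Types (V : {vspace 'rV[R]_d}) (x v : 'rV[R]_d) (xs : seq 'rV[R]_d).

Fixpoint sign_lists k : seq (seq bool) :=
  if k is k'.+1 then map (cons true) (sign_lists k') ++ map (cons false) (sign_lists k')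
  else [:: [::]].

Lemma mem_sign_lists k e : (e \in sign_lists k) = (size e == k).
Proof.
elim: k e => [|k IH] [|b e] //=; rewrite mem_cat.
  by apply/negP => /orP[] /mapP[].
rewrite eqSS -IH; apply/orP/idP => [[/mapP[f fk [_ ->]]|/mapP[f fk [_ ->]]]|ek]//.
by case: b; [left|right]; apply: map_f.
Qed.

Lemma sign_lists_uniq k : uniq (sign_lists k).
Proof.
elim: k => //= k IH; rewrite cat_uniq !map_inj_uniq ?IH => [|a b []//|a b []//].
by rewrite /= andbT; apply/hasPn => ? /mapP[e _ ->]; apply/negP => /mapP[].
Qed.

Definition generic xs v := all (fun x => inner v x != 0) xs.
Definition signs xs v := [seq 0 < inner v x | x <- xs].
Definition realizes V xs e : Prop :=
  exists2 v, v \in V & generic xs v /\ signs xs v = e.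

(** The number of chambers that the hyperplanes orthogonal to [xs] cut out of
    [V]: each chamber is identified by its list of signs. *)
Definition nchambers V xs : nat :=
  count (fun e => `[< realizes V xs e >]) (sign_lists (size xs)).

Lemma nchambers_nil V : nchambers V [::] = 1%N.
Proof.
rewrite /nchambers /= addn0 asboolT//.
by exists 0; rewrite ?mem0v.
Qed.

Lemma nchambers_null V x xs : x \in xs -> (V <= hyp x)%VS -> nchambers V xs = 0%N.
Proof.
move=> xxs Vx; rewrite /nchambers -[RHS](count_pred0 (sign_lists (size xs))).
apply: eq_count => e /=; apply/asboolP => -[v vV [/allP/(_ x xxs) vx _]].
by move/subvP: Vx => /(_ v vV); rewrite mem_hyp (negPf vx).
Qed.

Lemma signs_perturb xs v u : generic xs v -> exists2 e, 0 < e &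
  forall a, a = e \/ a = - e -> generic xs (v + a *: u) /\ signs xs (v + a *: u) = signs xs v.
Proof.
move=> /allP gv.
pose f (i : 'I_(size xs)) := `|inner v xs`_i|.
have f0 i : 0 < f i by rewrite normr_gt0 gv// mem_nth.
have [e e0 he] := small_scale (fun i : 'I_(size xs) => inner u xs`_i) f0.
exists e => // a ae.
have ha x : x \in xs -> `|a * inner u x| < `|inner v x|.
  move=> xxs; have lx : (index x xs < size xs)%N by rewrite index_mem.
  have := he (Ordinal lx); rewrite /f /= nth_index// => h.
  by case: ae => ->; rewrite ?mulNr ?normrN.
have sgn x : x \in xs -> (inner (v + a *: u) x != 0) /\
    ((0 < inner (v + a *: u) x) = (0 < inner v x)).
  move=> /[dup] /gv vx /ha; rewrite innerDl innerZl ltr_norml.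
  have [|vx0|->] := ltgtP (inner v x) 0; last by rewrite normr0; lra.
    move=> vx0; rewrite ltr0_norm// => /andP[_ h]; split; last by apply/negP; lra.
    by rewrite lt_eqF//; lra.
  rewrite gtr0_norm// => /andP[h _]; split; last by lra.
  by rewrite gt_eqF//; lra.
split; first by apply/allP => x /sgn[].
by apply/eq_in_map => x /sgn[].
Qed.

(** Deletion-restriction: a chamber of [xs] in [V] is either cut in two by the
    hyperplane of [x], which happens exactly when it meets that hyperplane in a
    chamber of the restricted arrangement, or left whole. *)
Lemma nchambers_cons V x xs : ~~ (V <= hyp x)%VS ->
  nchambers V (x :: xs) = (nchambers V xs + nchambers (V :&: hyp x) xs)%N.
Proof.
move=> /subvPn[u0 u0V]; rewrite mem_hyp => u0x.
have [u uV ux] : exists2 u, u \in V & 0 < inner u x.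
  move: u0x; rewrite neq_lt => /orP[h|]; last by exists u0.
  by exists (- u0); rewrite ?memvN// innerNl oppr_gt0.
have consE b e : realizes V (x :: xs) (b :: e) <->
    exists v, [/\ v \in V, inner v x != 0, (0 < inner v x) = b, generic xs v & signs xs v = e].
  split=> [[v vV [/andP[vx gv] [vb ve]]]|[v [vV vx vb gv ve]]]; first by exists v.
  by exists v => //; split; rewrite /= ?vx// vb -ve.
rewrite /nchambers /= count_cat !count_map -count_predUI; congr (_ + _)%N.
  apply: eq_count => e /=; rewrite -asbool_or; apply: asbool_equiv_eq.
  split=> [[|] /consE[v [vV _ _ gv ve]]|[v vV [gv ve]]]; try by exists v.
  have [vx|vx] := eqVneq (inner v x) 0; last first.
    by case: (boolP (0 < inner v x)) => h; [left|right]; apply/consE; exists v; rewrite (negPf h)|| rewrite h.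
  have [a a0 /(_ a (or_introl erefl))[ga sa]] := signs_perturb u gv.
  left; apply/consE; exists (v + a *: u).
  have vux : 0 < inner (v + a *: u) x by rewrite innerDl innerZl vx add0r mulr_gt0.
  by split; rewrite ?sa// ?gt_eqF// memvD// memvZ.
apply: eq_count => e /=; rewrite -asbool_and; apply: asbool_equiv_eq; split.
  move=> [/consE[v [vV vx vp gv ve]] /consE[w [wV wx wn gw we]]].
  have wx0 : inner w x < 0 by rewrite lt_neqAle wx leNgt wn.
  (* the point where the segment from [v] to [w] crosses the hyperplane *)
  exists ((- inner w x) *: v + inner v x *: w).
    rewrite memv_cap memvD ?memvZ//= mem_hyp innerDl !innerZl mulNr addrC.
    by rewrite mulrC subrr.
  have cE z : inner (- inner w x *: v + inner v x *: w) z =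
      (- inner w x) * inner v z + inner v x * inner w z by rewrite innerDl !innerZl.
  have key z : z \in xs -> (inner (- inner w x *: v + inner v x *: w) z != 0) /\
      ((0 < inner (- inner w x *: v + inner v x *: w) z) = (0 < inner v z)).
    move=> zxs; have vz : inner v z != 0 by apply: (allP gv).
    have wz : inner w z != 0 by apply: (allP gw).
    have := congr1 (nth false ^~ (index z xs)) (etrans ve (esym we)).
    rewrite !(nth_map z) ?index_mem// !nth_index// => vw; rewrite cE.
    have [vz0|vz0] := boolP (0 < inner v z); move: (vw); rewrite ?vz0 => wz0.
      have h : 0 < - inner w x * inner v z + inner v x * inner w z.
        by rewrite addr_gt0// mulr_gt0// ?oppr_gt0 -?wz0.
      by rewrite h gt_eqF.
    have h : - inner w x * inner v z + inner v x * inner w z < 0.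
      rewrite -oppr_gt0 opprD -!mulrN addr_gt0// mulr_gt0// ?oppr_gt0//.
        by rewrite lt_neqAle vz leNgt vz0.
      by rewrite lt_neqAle wz leNgt -wz0 (negPf vz0).
    by rewrite lt_eqF// ltNge ltW// (negPf vz0).
  split; first by apply/allP => z /key[].
  by rewrite -ve; apply/eq_in_map => z /key[].
move=> [v]; rewrite memv_cap mem_hyp => /andP[vV /eqP vx] [gv ve].
have [a a0 ha] := signs_perturb u gv.
have [ga sa] := ha a (or_introl erefl); have [ga' sa'] := ha (- a) (or_intror erefl).
split; apply/consE.
  exists (v + a *: u); have vux : 0 < inner (v + a *: u) x.
    by rewrite innerDl innerZl vx add0r mulr_gt0.
  by split; rewrite ?sa// ?gt_eqF// memvD// memvZ.
exists (v + - a *: u); have vux : inner (v + - a *: u) x < 0.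
  by rewrite innerDl innerZl vx add0r mulNr oppr_lt0 mulr_gt0.
by split; rewrite ?sa'// ?lt_eqF// ?memvD ?memvZ// ltNge ltW.
Qed.

(** A hyperplane listed twice cuts nothing: on the hyperplane itself, the second
    copy vanishes identically. *)
Lemma nchambers_redundant V x x' xs : x' \in xs ->
  (forall v, v \in V -> inner v x = 0 <-> inner v x' = 0) ->
  nchambers V (x :: xs) = nchambers V xs.
Proof.
move=> x'xs xx'.
have sub U : (U <= V)%VS -> (U <= hyp x)%VS -> (U <= hyp x')%VS.
  move=> /subvP UV /subvP Ux; apply/subvP => v vU.
  by rewrite mem_hyp; apply/eqP/(xx' _ (UV _ vU))/eqP; rewrite -mem_hyp Ux.
have [Vx|Vx] := boolP (V <= hyp x)%VS.
  by rewrite !(nchambers_null _ (sub _ (subvv _) Vx)) ?in_cons ?x'xs ?orbT.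
by rewrite nchambers_cons// [X in (_ + X)%N](nchambers_null x'xs) ?addn0// sub ?capvSl ?capvSr.
Qed.

End DeletionRestriction.

(** * Orders realized by points in general position *)

Section Braid.
Variables (R : realType) (d : nat).
Implicit Types (V : {vspace 'rV[R]_d}).

(** Listed so that the pairs containing the point [0] come first, ready to be
    removed by deletion-restriction. *)
Fixpoint pairs N : seq ('I_N * 'I_N) :=
  if N is N'.+1 then [seq (ord0, lift ord0 i) | i <- enum 'I_N'] ++
    [seq (lift ord0 ab.1, lift ord0 ab.2) | ab <- pairs N']
  else [::].

Lemma mem_pairs N (a b : 'I_N) : ((a, b) \in pairs N) = (a < b)%N.
Proof.
elim: N a b => [[]//|N IH] a b /=; rewrite mem_cat.
have [a'|] := unliftP ord0 a; last first.
  move=> ->; have [b' ->|->] := unliftP ord0 b.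
    by rewrite map_f ?mem_enum.
  by apply/negP => /orP[] /mapP[] => [? _ []|[? ?] _ []] //.
move=> ->; apply/orP/idP.
  case=> /mapP[x]; first by move=> _ /(congr1 fst)/= h; have := neq_lift ord0 a'; rewrite h eqxx.
  case: x => x y; rewrite IH => xy h; have /= /lift_inj -> := congr1 fst h.
  by have /= -> := congr1 snd h; rewrite /= /bump /= !add1n ltnS.
have [b' ->|->//] := unliftP ord0 b.
rewrite /= /bump /= !add1n ltnS => ab; right; apply/mapP.
by exists (a', b'); rewrite ?IH.
Qed.

Definition braid N (z : 'I_N -> 'rV[R]_d) : seq 'rV[R]_d :=
  [seq z ab.1 - z ab.2 | ab <- pairs N].

Definition tailpts N (z : 'I_N.+1 -> 'rV[R]_d) : 'I_N -> 'rV[R]_d := z \o lift ord0.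

Lemma braidS N (z : 'I_N.+1 -> 'rV[R]_d) :
  braid z = [seq z ord0 - tailpts z i | i <- enum 'I_N] ++ braid (tailpts z).
Proof. by rewrite /braid /= map_cat -!map_comp. Qed.

Lemma codomS (T : eqType) N (p : 'I_N.+1 -> T) :
  codom p = p ord0 :: codom (p \o lift ord0).
Proof. by rewrite !codomE enum_ordSl /= -map_comp. Qed.

Lemma gp_tail N V (z : 'I_N.+1 -> 'rV[R]_d) :
  in_general_position V z -> in_general_position V (tailpts z).
Proof.
move=> gp q; pose p a := omap q (unlift ord0 a).
have pl i : p (lift ord0 i) = Some (q i) by rewrite /p liftK.
have p0 : p ord0 = None by rewrite /p unlift_none.
have np : nblocks p = (nblocks q).+1.
  rewrite -(@nblocks_comp_inj _ _ _ q Some); last by move=> a b _ _ [].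
  have pq : codom (p \o lift ord0) = codom (Some \o q).
    by rewrite !codomE; apply: eq_map => i /=.
  rewrite /nblocks codomS pq /= p0; case: ifP => // /mapP[]//.
have := gp_dim p gp; rewrite np subSS => <-; congr (\dim (_ :&: _)).
apply/vspaceP => v; apply/tiesP/tiesP => [vq a b|vp a b ab]; last first.
  by apply: vp; rewrite !pl ab.
have [a' ->|->] := unliftP ord0 a; have [b' ->|->] := unliftP ord0 b => //.
- by rewrite !pl => -[/vq].
- by rewrite pl p0.
- by rewrite pl p0.
Qed.

(** On the hyperplane where the points [0] and [i] agree, the point [0] may be
    given the label of [i]: this transfers general position to the others. *)
Lemma cap_ties_merge (T : eqType) N V (z : 'I_N.+1 -> 'rV[R]_d) i (q : 'I_N -> T) :
  (V :&: hyp (z ord0 - tailpts z i) :&: ties (tailpts z) q =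
   V :&: ties z (q \o odflt i \o unlift ord0))%VS.
Proof.
apply/vspaceP => v; rewrite !memv_cap -andbA; congr (_ && _).
apply/andP/tiesP => [[]|vp]; rewrite mem_hyp innerBr subr_eq0.
  move=> /eqP v0 /tiesP vq a b /=.
  have [a' ->|->] := unliftP ord0 a; have [b' ->|->] := unliftP ord0 b => //;
    rewrite ?liftK ?unlift_none /=.
  - exact: vq.
  - by rewrite v0; exact: vq.
  - by rewrite v0; exact: vq.
split; first by apply/eqP/vp; rewrite /= unlift_none liftK.
by apply/tiesP => a b ab; apply: vp; rewrite /= !liftK.
Qed.

Lemma nblocks_merge (T : eqType) N i (q : 'I_N -> T) :
  nblocks (q \o odflt i \o unlift ord0) = nblocks q.
Proof.
rewrite /nblocks codomS /= unlift_none /=.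
have -> : codom ((q \o odflt i \o unlift ord0) \o lift ord0) = codom q.
  by rewrite !codomE; apply: eq_map => a /=; rewrite liftK.
by rewrite codom_f.
Qed.

Lemma dim_merge N V (z : 'I_N.+1 -> 'rV[R]_d) i : in_general_position V z ->
  \dim (V :&: hyp (z ord0 - tailpts z i)) = (\dim V).-1.
Proof.
move=> gp; have -> : (V :&: hyp (z ord0 - tailpts z i) =
    V :&: hyp (z ord0 - tailpts z i) :&: ties (tailpts z) id)%VS.
  apply/esym/capv_idPl/subvP => v _.
  by apply/tiesP => a b ->.
rewrite cap_ties_merge gp_dim// nblocks_merge nblocks_inj// subSnn.
by rewrite subn1.
Qed.

Lemma gp_merge N V (z : 'I_N.+1 -> 'rV[R]_d) i : in_general_position V z ->
  in_general_position (V :&: hyp (z ord0 - tailpts z i)) (tailpts z).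
Proof.
move=> gp q; rewrite cap_ties_merge gp_dim// nblocks_merge dim_merge//.
by have := nblocks_le q; lia.
Qed.

Lemma nchambers_star N V (z : 'I_N.+1 -> 'rV[R]_d) (l : seq 'I_N) :
  in_general_position V z -> (0 < \dim V)%N -> uniq l ->
  nchambers V ([seq z ord0 - tailpts z i | i <- l] ++ braid (tailpts z)) =
  (nchambers V (braid (tailpts z)) +
   \sum_(i <- l) nchambers (V :&: hyp (z ord0 - tailpts z i)) (braid (tailpts z)))%N.
Proof.
move=> gp V0; elim: l => [|i l IH] /=; first by rewrite big_nil addn0.
move=> /andP[il ul]; rewrite nchambers_cons; last first.
  apply/negP => /capv_idPl h; have := dim_merge i gp; rewrite h; lia.
rewrite IH// big_cons -addnA; congr (_ + _)%N; rewrite addnC; congr (_ + _)%N.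
(* Where [0] agrees with [i], comparing [0] to [j] is comparing [i] to [j],
   which the arrangement of the other points already does. *)
set W := (V :&: _)%VS.
elim: l il {IH ul} => //= j l IH; rewrite in_cons negb_or => /andP[ij il].
have [ab [abp abE]] : exists ab, ab \in pairs N /\ (ab = (i, j) \/ ab = (j, i)).
  have := ij; rewrite -val_eqE neq_ltn => /orP[] h.
    by exists (i, j); rewrite mem_pairs; split; [|left].
  by exists (j, i); rewrite mem_pairs; split; [|right].
rewrite (nchambers_redundant (x' := tailpts z ab.1 - tailpts z ab.2)) ?IH//.
  by rewrite mem_cat (map_f (fun ab => tailpts z ab.1 - tailpts z ab.2)) ?orbT.
move=> v; rewrite memv_cap mem_hyp !innerBr subr_eq0 => /andP[_ /eqP ->].
by case: abE => -> /=; split; lra.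
Qed.

(** Removing a point from [N.+1] leaves the orders of the [N] others, and each of
    the [N] hyperplanes on which it agrees with another point adds as many pieces
    as it has chambers: this is the recursion of the numbers [DA]. *)
Lemma nchambers_braid N V (z : 'I_N.+2 -> 'rV[R]_d) : in_general_position V z ->
  nchambers V (braid z) = DA N.+2 (\dim V).
Proof.
elim: N V z => [|N IH] V z gp.
  rewrite braidS (_ : braid (tailpts z) = [::]) ?cats0; last first.
    by rewrite /braid /= enum_ord0.
  rewrite enum_ordSl enum_ord0 /=; set x := _ - _.
  have := dim_merge ord0 gp; rewrite -/x.
  case: (posnP (\dim V)) => [V0|V0] dV.
    rewrite V0 DA0 (nchambers_null (mem_head _ _))//.
    by move/eqP: V0; rewrite dimv_eq0 => /eqP ->; rewrite sub0v.
  rewrite -[X in DA _ X](prednK V0) DA_2 nchambers_cons ?nchambers_nil//.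
  by apply/negP => /capv_idPl h; move: dV; rewrite h; lia.
case: (posnP (\dim V)) => [V0|V0].
  rewrite V0 DA0 braidS enum_ordSl /= (nchambers_null (mem_head _ _))//.
  by move/eqP: V0; rewrite dimv_eq0 => /eqP ->; rewrite sub0v.
rewrite braidS nchambers_star ?enum_uniq// (IH _ _ (gp_tail gp)).
rewrite (eq_bigr (fun=> DA N.+2 (\dim V).-1)) => [|i _]; last first.
  by rewrite (IH _ _ (gp_merge _ gp)) dim_merge.
rewrite big_enum /= sum_nat_const card_ord.
by case: (\dim V) V0 => // k _; rewrite [RHS]DA_rec.
Qed.

Definition realized N V (z : 'I_N -> 'rV[R]_d) (r : 'I_N -> nat) : Prop :=
  exists2 v, v \in V & forall a b, (inner v (z a) <= inner v (z b)) = (r a <= r b)%N.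

(** By induction on the level of a point in one of the labellings, its level in
    the other is at least as large. *)
Lemma onto_order_inj n N (p q : 'I_n -> 'I_N) :
  (forall c, exists a, p a = c) -> (forall c, exists a, q a = c) ->
  (forall a b, (p a <= p b)%N = (q a <= q b)%N) -> p =1 q.
Proof.
suff le_pq (r t : 'I_n -> 'I_N) : (forall c, exists a, r a = c) ->
    (forall a b, (r a <= r b)%N = (t a <= t b)%N) -> forall a, (r a <= t a)%N.
  move=> po qo pq a; apply/val_inj/eqP.
  by rewrite eqn_leq (le_pq p q)//= (le_pq q p)// => b c; rewrite pq.
move=> ro rt a; have [c] := ubnP (r a); elim: c a => // c IH a.
rewrite ltnS leq_eqVlt => /orP[/eqP ra|]; last exact: IH.
case: c => [|c] in IH ra *; first by rewrite ra.
have cN : (c < N)%N by rewrite (leq_trans _ (ltn_ord (r a)))// ra.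
have [b rb] := ro (Ordinal cN).
have := IH b; rewrite rb leqnn => /(_ isT) /leq_ltn_trans; rewrite ra; apply.
by rewrite ltnNge -rt -ltnNge rb ra.
Qed.

Lemma perm_onto N (r : 'S_N) c : exists a, r a = c.
Proof. by exists ((r^-1)%g c); rewrite permKV. Qed.

Lemma perm_order_inj N (r r' : 'S_N) :
  (forall a b, (r a <= r b)%N = (r' a <= r' b)%N) -> r = r'.
Proof. by move=> rr'; apply/permP; apply: onto_order_inj => // c; exact: perm_onto. Qed.

(** A chamber of the braid arrangement, given by its signs, is the same thing as
    the order that its vectors induce on the points. *)
Lemma card_realized N V (z : 'I_N -> 'rV[R]_d) : (1 < N)%N ->
  in_general_position V z ->
  #|[set r : 'S_N | `[< realized V z (fun a => r a) >]]%SET| = DA N (\dim V).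
Proof.
case: N z => [|[|N]]// z _ gp; rewrite -(nchambers_braid gp).
pose e (r : 'S_N.+2) := [seq (r ab.2 < r ab.1)%N | ab <- pairs N.+2].
have eI : injective e.
  move=> r r' /eq_in_map rr'; apply: perm_order_inj => a b.
  have [ab|ab|/val_inj ->] := ltngtP (val a) (val b); last by rewrite !leqnn.
    by have := rr' (a, b); rewrite mem_pairs ab => /(_ isT) /= h; rewrite leqNgt h -leqNgt.
  have := rr' (b, a); rewrite mem_pairs ab => /(_ isT) /= h.
  have ne (s : 'S_N.+2) : (s a == s b) = false.
    by rewrite (inj_eq perm_inj) -val_eqE gtn_eqF.
  by rewrite (leq_eqVlt (r a)) (leq_eqVlt (r' a)) !val_eqE !ne h.
have sE v (r : 'S_N.+2) : (forall a b, (inner v (z a) <= inner v (z b)) = (r a <= r b)%N) ->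
    signs (braid z) v = e r.
  move=> vr; rewrite /signs /braid -map_comp; apply: eq_map => -[a b] /=.
  by rewrite innerBr subr_gt0 ltNge vr -ltnNge.
rewrite /nchambers -size_filter cardE -(size_map e).
apply/perm_size/uniq_perm.
- by rewrite (map_inj_uniq eI) enum_uniq.
- by rewrite filter_uniq// sign_lists_uniq.
move=> f; rewrite mem_filter mem_sign_lists; apply/mapP/andP => [[r]|[/asboolP]].
  rewrite mem_enum inE => /asboolP[v vV vr] ->; split; last by rewrite !size_map.
  apply/asboolP; exists v => //; split; last exact: sE.
  apply/allP => x /mapP[[a b]]; rewrite mem_pairs => ab ->.
  rewrite innerBr subr_eq0; apply/negP => /eqP vab.
  have := vr a b; have := vr b a; rewrite vab lexx => h1 h2.
  have : r a == r b by rewrite -val_eqE eqn_leq -h1 -h2.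
  by rewrite (inj_eq perm_inj) -val_eqE ltn_eqF.
move=> [v vV [/allP gv sv]] _.
have vI : injective (fun a => inner v (z a)).
  move=> a b /eqP; apply: contraTeq => ab.
  have : inner v (z a - z b) != 0 -> inner v (z a) != inner v (z b).
    by rewrite innerBr subr_eq0.
  have : inner v (z b - z a) != 0 -> inner v (z a) != inner v (z b).
    by rewrite innerBr subr_eq0 eq_sym.
  have := ab; rewrite -val_eqE neq_ltn => /orP[] h h1 h2; [apply: h2|apply: h1].
    by apply: gv; apply/mapP; exists (a, b); rewrite ?mem_pairs.
  by apply: gv; apply/mapP; exists (b, a); rewrite ?mem_pairs.
have [r rv] := perm_ranking vI.
have vr a b : (inner v (z a) <= inner v (z b)) = (r a <= r b)%N by rewrite rv.
exists r; last by rewrite -sv (sE _ _ vr).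
by rewrite mem_enum inE; apply/asboolP; exists v.
Qed.

End Braid.

(** * Weak orders and their refinements *)

Definition onto n N (p : {ffun 'I_n -> 'I_N}) := [forall c, exists a, p a == c].

Lemma ontoP n N (p : {ffun 'I_n -> 'I_N}) : reflect (forall c, exists a, p a = c) (onto p).
Proof.
apply: (iffP forallP) => h c; first by have /existsP[a /eqP] := h c; exists a.
by have [a <-] := h c; apply/existsP; exists a.
Qed.

(** For realized orders: the cone of [p] is a face of the chamber of [s]. *)
Definition refines n N (s : 'S_n) (p : {ffun 'I_n -> 'I_N}) :=
  [forall a, forall b, (s a <= s b)%N ==> (p a <= p b)%N].

Lemma refinesP n N (s : 'S_n) (p : {ffun 'I_n -> 'I_N}) :
  reflect (forall a b, (s a <= s b)%N -> (p a <= p b)%N) (refines s p).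
Proof.
apply: (iffP forallP) => h a; first by move=> b; apply/implyP; have /forallP := h a; apply.
by apply/forallP => b; apply/implyP; apply: h.
Qed.

Section Monotone.
Variables n N : nat.
Implicit Types (I : {set 'I_n}) (q : {ffun 'I_n.+1 -> 'I_N.+1}).

Definition nsteps I (k : nat) : nat := #|[set i in I | (i < k)%N]%SET|.

Lemma nsteps0 I : nsteps I 0 = 0%N.
Proof. by apply: eq_card0 => i; rewrite !inE andbF. Qed.

Lemma nstepsS I (i : 'I_n) : nsteps I i.+1 = (nsteps I i + (i \in I))%N.
Proof.
rewrite /nsteps; have [iI|iI] := boolP (i \in I); last first.
  rewrite addn0; apply: eq_card => j; rewrite !inE ltnS leq_eqVlt.
  by have [/val_inj ->|] := eqVneq (val j) (val i); rewrite ?(negPf iI).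
rewrite addn1 (cardsD1 i) !inE iI ltnS leqnn /= add1n; congr _.+1.
apply: eq_card => j; rewrite !inE ltnS leq_eqVlt -val_eqE.
by have [->|] := eqVneq (val j) (val i); rewrite /= ?ltnn ?andbF.
Qed.

Lemma nsteps_max I : nsteps I n = #|I|.
Proof. by apply: eq_card => i; rewrite inE ltn_ord andbT. Qed.

Lemma nsteps_mono I j k : (j <= k)%N -> (nsteps I j <= nsteps I k)%N.
Proof.
move=> jk; apply/subset_leq_card/fintype.subsetP => i.
by rewrite !inE => /andP[-> /leq_trans]; apply.
Qed.

Lemma nsteps_le I k : (nsteps I k <= #|I|)%N.
Proof. by apply/subset_leq_card/fintype.subsetP => i; rewrite !inE => /andP[]. Qed.

(** A monotone map onto an interval is determined by the set of the positions
    where it makes a step. *)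
Lemma card_monotone_onto :
  #|[set q : {ffun 'I_n.+1 -> 'I_N.+1} | onto q & refines 1%g q]%SET| = 'C(n, N).
Proof.
rewrite -[in RHS](card_ord n) -card_draws.
pose F I : {ffun 'I_n.+1 -> 'I_N.+1} := [ffun a : 'I_n.+1 => inord (nsteps I a)].
have FE I (a : 'I_n.+1) : #|I| = N -> F I a = nsteps I a :> nat.
  by move=> cI; rewrite ffunE inordK// ltnS -cI nsteps_le.
have FI : {in [set A : {set 'I_n} | #|A| == N]%SET &, injective F}.
  move=> I J; rewrite !inE => /eqP cI /eqP cJ IJ; apply/setP => i.
  have e k : (k < n.+1)%N -> nsteps I k = nsteps J k.
    move=> kn; have := FE I (Ordinal kn) cI; rewrite IJ FE//=.
  have := nstepsS I i; rewrite e ?ltnS// nstepsS e ?(leqW (ltn_ord i))// => /addnI.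
  by do 2 case: (_ \in _).
rewrite -(card_in_imset FI); apply: eq_card => q; rewrite inE.
apply/andP/imsetP => [[/ontoP qs /refinesP qm]|[I]]; last first.
  rewrite inE => /eqP cI ->; split.
    apply/ontoP => c.
    have ex : exists k, (c <= nsteps I k)%N.
      by exists n; rewrite nsteps_max cI -ltnS.
    case: (ex_minnP ex) => k ck kmin.
    have kn : (k < n.+1)%N by rewrite ltnS; apply: kmin; rewrite nsteps_max cI -ltnS.
    exists (Ordinal kn); apply: val_inj; rewrite /= FE//=.
    apply/eqP; rewrite eqn_leq ck andbT.
    case: k kn kmin {ck} => [|k] kn kmin; first by rewrite nsteps0.
    have := nstepsS I (Ordinal (kn : (k < n)%N)) => /= ->.
    have : ~~ (c <= nsteps I k)%N by apply/negP => /kmin; rewrite ltnn.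
    by rewrite -ltnNge; case: (_ \in _) => /=; lia.
  by apply/refinesP => a b; rewrite !permE !FE// => /nsteps_mono.
have qmono (a b : 'I_n.+1) : (a <= b)%N -> (q a <= q b)%N by move=> ab; apply: qm; rewrite !permE.
pose lo (i : 'I_n) : 'I_n.+1 := widen_ord (leqnSn n) i.
pose up (i : 'I_n) : 'I_n.+1 := lift ord0 i.
pose I := [set i | (q (lo i) < q (up i))%N]%SET.
have step i : (q (up i) <= (q (lo i)).+1)%N.
  rewrite leqNgt; apply/negP => h.
  have hN : ((q (lo i)).+1 < N.+1)%N := ltn_trans h (ltn_ord _).
  have [a qa] := qs (Ordinal hN); have qa' := congr1 val qa; rewrite /= in qa'.
  have [ai|ia] := leqP a i.
    by have := qmono a (lo i) ai; rewrite qa' ltnn.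
  by have := qmono (up i) a ia; rewrite qa' leqNgt h.
have qE a : q a = nsteps I a :> nat.
  case: a => k; elim: k => [|k IH] kn.
    rewrite nsteps0; have [a qa] := qs ord0.
    have := qmono (Ordinal kn) a (leq0n _); rewrite qa /=; lia.
  have kn' : (k < n)%N by [].
  have := nstepsS I (Ordinal kn') => /= ->.
  have loE : lo (Ordinal kn') = Ordinal (ltnW kn) by apply: val_inj.
  have upE : up (Ordinal kn') = Ordinal kn by apply: val_inj.
  have /= <- := IH (ltnW kn).
  have := step (Ordinal kn'); have := qmono _ _ (leqnSn k : (Ordinal (ltnW kn) <= Ordinal kn)%N).
  by rewrite inE loE upE /=; case: ltnP => /=; lia.
have cI : #|I| = N.
  rewrite -nsteps_max; have := qE ord_max => /= <-.
  have [a qa] := qs ord_max; have := qmono a ord_max (leq_ord a).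
  have := leq_ord (q ord_max); rewrite qa /=; lia.
exists I; first by rewrite inE cI.
by apply/ffunP => a; apply: val_inj; rewrite /= FE// qE.
Qed.

End Monotone.

Section Symmetrization.
Variables n N : nat.
Implicit Types (s : 'S_n) (r : 'S_N) (p : {ffun 'I_n -> 'I_N}).

Lemma card_refined_by s : (0 < n)%N -> (0 < N)%N ->
  #|[set p : {ffun 'I_n -> 'I_N} | onto p & refines s p]%SET| = 'C(n.-1, N.-1).
Proof.
move=> n0 N0; have [n' nE] : exists n', n = n'.+1 by exists n.-1; rewrite prednK.
have [N' NE] : exists N', N = N'.+1 by exists N.-1; rewrite prednK.
clear n0 N0; subst n N; rewrite -card_monotone_onto.
pose F (p : {ffun 'I_n'.+1 -> 'I_N'.+1}) : {ffun 'I_n'.+1 -> 'I_N'.+1} := [ffun a => p (s a)].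
have FI : injective F.
  move=> p q /ffunP pq; apply/ffunP => a.
  by have := pq ((s^-1)%g a); rewrite !ffunE permKV.
rewrite -[RHS](card_imset _ FI); apply: eq_card => p; rewrite inE.
apply/andP/imsetP => [[/ontoP ps /refinesP pr]|[q]].
  exists [ffun a => p ((s^-1)%g a)]; last by apply/ffunP => a; rewrite !ffunE permK.
  rewrite inE; apply/andP; split.
    by apply/ontoP => c; have [a <-] := ps c; exists (s a); rewrite ffunE permK.
  apply/refinesP => a b; rewrite !permE !ffunE => ab.
  by apply: pr; rewrite !permKV.
rewrite inE => /andP[/ontoP qs /refinesP qr] ->; split.
  by apply/ontoP => c; have [a <-] := qs c; exists ((s^-1)%g a); rewrite ffunE permKV.
by apply/refinesP => a b ab; rewrite !ffunE; apply: qr; rewrite !permE.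
Qed.

Definition relabel r p : {ffun 'I_n -> 'I_N} := [ffun a => r (p a)].

Lemma relabel_inj r : injective (relabel r).
Proof.
move=> p q /ffunP pq; apply/ffunP => a.
by have := pq a; rewrite !ffunE => /perm_inj.
Qed.

Lemma onto_relabel r p : onto (relabel r p) = onto p.
Proof.
apply/ontoP/ontoP => ps c.
  by have [a] := ps (r c); rewrite ffunE => /perm_inj; exists a.
by have [a pa] := ps ((r^-1)%g c); exists a; rewrite ffunE pa permKV.
Qed.

(** Permuting the blocks of a weak order does not change the number of its
    refinements, as the points can be kept in the same order inside each block. *)
Lemma card_refinements_le r p :
  (#|[set s | refines s p]%SET| <= #|[set s | refines s (relabel r p)]%SET|)%N.
Proof.
(* The points are ranked first by their new level, then as in [s]. *)
pose key s (a : 'I_n) := (relabel r p a * n + s a)%N.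
have keylt s a b : (key s a < key s b)%N =
    (relabel r p a < relabel r p b)%N || ((p a == p b) && (s a < s b)%N).
  have := ltn_ord (s a); have := ltn_ord (s b); rewrite /key.
  have -> : (p a == p b) = (relabel r p a == relabel r p b).
    by rewrite !ffunE (inj_eq perm_inj).
  rewrite -val_eqE /=.
  move: (nat_of_ord (s a)) (nat_of_ord (s b)) => x y yn xn.
  move: (nat_of_ord (relabel r p a)) (nat_of_ord (relabel r p b)) => u v.
  by case: (ltngtP u v) => [h|h|->] /=; [nia|nia|rewrite ltn_add2l].
have keyI s : injective (key s).
  move=> a b ab; have := keylt s a b; have := keylt s b a; rewrite ab ltnn.
  case: (ltngtP (relabel r p a) (relabel r p b)) => //= /val_inj.
  rewrite !ffunE => /perm_inj ->; rewrite eqxx /=.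
  by case: (ltngtP (s a) (s b)) => // /val_inj/perm_inj.
have rk s := perm_ranking (keyI s).
pose F s := sval (cid (rk s)).
have FE s a b : (F s a <= F s b)%N = (key s a <= key s b)%N by rewrite /F; case: cid.
have Flt s a b : (F s a < F s b)%N = (key s a < key s b)%N by rewrite !ltnNge FE.
have FI : {in [set s | refines s p]%SET &, injective F}.
  move=> s t; rewrite !inE => /refinesP sp /refinesP tp st.
  apply: perm_order_inj => a b; rewrite (leqNgt (s a)) (leqNgt (t a)); congr (~~ _).
  have lt_in (u : 'S_n) : (forall a b, (u a <= u b)%N -> (p a <= p b)%N) ->
      (u b < u a)%N = (p b < p a)%N || ((p a == p b) && (F u b < F u a)%N).
    move=> up; rewrite Flt keylt !ffunE [p b == p a]eq_sym.
    have [pab|] := eqVneq (p a) (p b); first by rewrite pab !ltnn.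
    rewrite -val_eqE /= orbF neq_ltn => /orP[] h.
      rewrite [RHS]ltnNge (ltnW h); apply/negP => /ltnW/up.
      by rewrite leqNgt h.
    by rewrite h ltnNge; apply/negP => /up; rewrite leqNgt h.
  by rewrite (lt_in s sp) (lt_in t tp) st.
rewrite -(card_in_imset FI); apply/subset_leq_card/fintype.subsetP => _ /imsetP[s _ ->].
rewrite inE; apply/refinesP => a b; rewrite FE leqNgt keylt; apply: contraR.
by rewrite -ltnNge => ->.
Qed.

Lemma card_refinements r p :
  #|[set s | refines s (relabel r p)]%SET| = #|[set s | refines s p]%SET|.
Proof.
apply/eqP; rewrite eqn_leq card_refinements_le andbT.
have {2}-> : p = relabel (r^-1)%g (relabel r p).
  by apply/ffunP => a; rewrite !ffunE permK.
exact: card_refinements_le.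
Qed.

(** Weak orders with [N] levels are counted by the orbits of the permutations of
    their levels, along which the number of refinements is constant.  So if every
    orbit contains [D] good labellings, then among all pairs of a weak order and
    a refinement, [D] out of [N!] are good. *)
Lemma card_good_pairs (good : pred {ffun 'I_n -> 'I_N}) (D : nat) :
  (0 < n)%N -> (0 < N)%N ->
  (forall p, onto p -> #|[set r | good (relabel r p)]%SET| = D) ->
  (N`! * \sum_(p : {ffun 'I_n -> 'I_N} | onto p && good p) #|[set s | refines s p]%SET| =
   n`! * 'C(n.-1, N.-1) * D)%N.
Proof.
move=> n0 N0 hD.
have -> : (n`! * 'C(n.-1, N.-1) = \sum_(p : {ffun 'I_n -> 'I_N} | onto p) #|[set s | refines s p]%SET|)%N.
  transitivity (\sum_(s : 'S_n) #|[set p : {ffun 'I_n -> 'I_N} | onto p & refines s p]%SET|)%N.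
    rewrite (eq_bigr (fun=> 'C(n.-1, N.-1))) => [|s _]; last exact: card_refined_by.
    by rewrite sum_nat_const card_Sn.
  under eq_bigr do rewrite -sum1dep_card big_mkcondr /=.
  rewrite exchange_big; apply: eq_bigr => p _.
  by rewrite -big_mkcond sum1dep_card.
transitivity (\sum_(r : 'S_N) \sum_(p : {ffun 'I_n -> 'I_N} | onto p && good p) #|[set s | refines s p]%SET|)%N.
  by rewrite sum_nat_const card_Sn.
transitivity (\sum_(r : 'S_N) \sum_(p : {ffun 'I_n -> 'I_N} | onto p && good (relabel r p)) #|[set s | refines s p]%SET|)%N.
  apply: eq_bigr => r _; rewrite (reindex_inj (@relabel_inj r)) /=.
  apply: eq_big => [p|p _]; first by rewrite onto_relabel.
  exact: card_refinements.
under eq_bigr do rewrite big_mkcondr /=.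
rewrite exchange_big /= big_distrl; apply: eq_bigr => p ps /=.
by rewrite -big_mkcond sum_nat_const mulnC -(hD p ps) -sum1dep_card sum1_card.
Qed.

End Symmetrization.

(** * Weyl chambers *)

Section Cones.
Variables (R : realType) (d n : nat).
Implicit Types (y : 'I_n -> 'rV[R]_d) (p q : 'I_n -> nat) (u v w x : 'rV[R]_d).

Lemma inner_continuous x : continuous (fun v => inner v x).
Proof.
suff h (r : seq 'I_d) : continuous (fun v => \sum_(i <- r) v 0 i * x 0 i) by exact: h.
elim: r => [|i r IH].
  have -> : (fun v => \sum_(i <- [::]) v 0 i * x 0 i) = cst 0.
    by apply/funext => v; rewrite big_nil.
  exact: cst_continuous.
have -> : (fun v => \sum_(j <- i :: r) v 0 j * x 0 j) =
    (fun v => v 0 i * x 0 i + \sum_(j <- r) v 0 j * x 0 j).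
  by apply/funext => v; rewrite big_cons.
move=> v; apply: (@continuousD _ _ 'rV[R]_d); last exact: IH.
apply: (@continuousM _ 'rV[R]_d); first exact: coord_continuous.
exact: cst_continuous.
Qed.

Lemma line_continuous v u : continuous (fun t : R => v + t *: u).
Proof.
by move=> t; apply: cvgD; [exact: cvg_cst|apply: scalel_continuous].
Qed.

(** If [p] is realized by a vector, this is the face of the arrangement having
    this vector in its relative interior. *)
Definition cone y p : set 'rV[R]_d :=
  [set v | forall a b, (p a <= p b)%N -> inner v (y a) <= inner v (y b)].

Definition realizing y p : set 'rV[R]_d :=
  [set v | forall a b, (inner v (y a) <= inner v (y b)) = (p a <= p b)%N].

Lemma realizing_lt y p v a b : realizing y p v ->
  (inner v (y a) < inner v (y b)) = (p a < p b)%N.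
Proof. by move=> pv; rewrite ltNge ltnNge pv. Qed.

Lemma realizing_eq y p v a b : realizing y p v ->
  (inner v (y a) == inner v (y b)) = (p a == p b).
Proof. by move=> pv; rewrite eq_le !pv eqn_leq. Qed.

Lemma realizing_cone y p : realizing y p `<=` cone y p.
Proof. by move=> v pv a b; rewrite pv. Qed.

Lemma cone_order y p q v : realizing y q v -> cone y p v ->
  forall a b, (p a <= p b)%N -> (q a <= q b)%N.
Proof. by move=> qv pv a b /pv; rewrite qv. Qed.

Lemma cone_eq y p q : (exists v, realizing y p v) -> (exists v, realizing y q v) ->
  cone y p = cone y q -> forall a b, (p a <= p b)%N = (q a <= q b)%N.
Proof.
move=> [v pv] [w qw] pq a b; apply/idP/idP.
  by apply: (cone_order qw); rewrite pq; apply: realizing_cone.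
by apply: (cone_order pv); rewrite -pq; apply: realizing_cone.
Qed.

Lemma cone_closed y p : closed (cone y p).
Proof.
have -> : cone y p = \bigcap_(ab in [set ab : 'I_n * 'I_n | (p ab.1 <= p ab.2)%N])
    ((fun v => inner v (y ab.1 - y ab.2)) @^-1` [set t | t <= 0]).
  apply/seteqP; split => v h.
    by move=> [a b] /= ab; rewrite innerBr subr_le0; apply: h.
  by move=> a b ab; have := h (a, b) ab; rewrite /= innerBr subr_le0.
apply: closed_bigI => ab _; apply: preimage_closed; last exact: closed_le.
by move=> v _; apply: inner_continuous.
Qed.

Lemma coneD y p v w a b : 0 <= a -> 0 <= b ->
  cone y p v -> cone y p w -> cone y p (a *: v + b *: w).
Proof.
move=> a0 b0 pv pw i j ij; rewrite !innerDl !innerZl.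
by rewrite lerD// ler_wpM2l// ?pv ?pw.
Qed.

Lemma realizingD y p v w a b : 0 < a -> 0 <= b ->
  realizing y p v -> cone y p w -> realizing y p (a *: v + b *: w).
Proof.
move=> a0 b0 pv pw i j; have [ij|ji] := leqP (p i) (p j).
  by apply: coneD; [exact: ltW|exact: b0|exact: realizing_cone|exact: pw|exact: ij].
apply/negbTE; rewrite -ltNge !innerDl !innerZl ltr_leD//.
  by rewrite ltr_pM2l// (realizing_lt _ _ pv).
by rewrite ler_wpM2l// pw// ltnW.
Qed.

Lemma closure_realizing y p : (exists v, realizing y p v) ->
  closure (realizing y p) = cone y p.
Proof.
move=> [w pw]; apply/seteqP; split.
  move/closure_id: (@cone_closed y p) => ->.
  by apply: closure_subset; exact: realizing_cone.
move=> v pv B vB.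
have : nbhs (0 : R) ((fun t : R => v + t *: w) @^-1` B).
  by apply: line_continuous; rewrite scale0r addr0.
move=> /nbhs_ballP[e /= e0 he]; exists (v + (e / 2) *: w); split.
  rewrite addrC -[v]scale1r; apply: realizingD => //.
  by rewrite divr_gt0.
apply: he; rewrite /ball /= sub0r normrN gtr0_norm ?divr_gt0// ltr_pdivrMr//.
by rewrite ltr_pMr// ltr1n.
Qed.

Lemma weyl_complementP y v :
  weyl_complement y v <-> injective (fun a => inner v (y a)).
Proof.
split=> [h a b /eqP|vI [[a b] /= ab]].
  apply: contraTeq => ab; apply/negP => /eqP vab; apply: h.
  have := ab; rewrite -val_eqE neq_ltn => /orP[] lt_ab; [exists (a, b)|exists (b, a)] => //;
    by rewrite /perp /= innerBr vab subrr.
rewrite /perp /= innerBr => /eqP; rewrite subr_eq0 => /eqP /vI abE.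
by move: ab; rewrite abE ltnn.
Qed.

Lemma realizing_perm_complement y (s : 'S_n) :
  realizing y (fun a => s a) `<=` weyl_complement y.
Proof.
move=> v sv; apply/weyl_complementP => a b /eqP.
by rewrite (realizing_eq _ _ sv) => /eqP/val_inj/perm_inj.
Qed.

(** No hyperplane can be crossed along a connected set avoiding all of them,
    because the image of this set under an inner product is an interval; and the
    vectors inducing a given order form a convex set. *)
Lemma component_realizing y (s : 'S_n) v : realizing y (fun a => s a) v ->
  connected_component (weyl_complement y) v = realizing y (fun a => s a).
Proof.
move=> sv; apply/seteqP; split => [u [C [Cv CA cC] Cu] a b|u su].
  have same i j : inner v (y i) < inner v (y j) -> inner u (y i) < inner u (y j).
    move=> ij.
    have [k1 k2] : inner v (y j - y i) > 0 /\ inner u (y j - y i) != 0.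
      rewrite !innerBr subr_gt0 ij subr_eq0; split => //.
      apply/eqP => /((weyl_complementP _ _).1 (CA _ Cu)) ji.
      by rewrite ji ltxx in ij.
    have cf : connected ((fun w => inner w (y j - y i)) @` C).
      apply: connected_continuous_connected => //.
      by apply: continuous_subspaceT; exact: inner_continuous.
    move/connected_intervalP : cf => itv.
    rewrite -subr_gt0 -innerBr lt_neqAle eq_sym k2 leNgt /=; apply/negP => u0.
    have [w Cw /eqP] := itv _ _ (imageP _ Cu) (imageP _ Cv) 0
      (introT andP (conj (ltW u0) (ltW k1))).
    rewrite innerBr subr_eq0 => /eqP /((weyl_complementP _ _).1 (CA _ Cw)) ji.
    by rewrite ji ltxx in ij.
  have [|] := leqP (s a) (s b); last first.
    by rewrite -(realizing_lt _ _ sv) => /same; rewrite ltNge => /negbTE.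
  rewrite leq_eqVlt => /orP[/eqP/val_inj/perm_inj ->|]; first by rewrite lexx.
  by rewrite -(realizing_lt _ _ sv) => /same/ltW.
pose f t : 'rV[R]_d := v + t *: (u - v).
exists (f @` `[0, 1]%classic).
  split.
  - by exists 0; rewrite /f ?scale0r ?addr0//= in_itv /= lexx ler01.
  - move=> _ [t /= /[!in_itv] /andP[t0 t1] <-].
    apply: (@realizing_perm_complement y s).
    have -> : f t = (1 - t) *: v + t *: u.
      by rewrite /f scalerBr scalerBl scale1r addrA addrAC.
    have [->|t_lt1] := eqVneq t 1; first by rewrite subrr scale0r add0r scale1r.
    apply: realizingD => //; last exact: realizing_cone.
    by rewrite subr_gt0 lt_neqAle t_lt1.
  - apply: connected_continuous_connected; first exact: segment_connected.
    by apply: continuous_subspaceT; exact: line_continuous.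
by exists 1; rewrite /f ?scale1r ?subrKC//= in_itv /= lexx ler01.
Qed.

(** A vector outside of the hyperplanes induces a total order, which determines
    its connected component. *)
Lemma weyl_tessellationE y : weyl_tessellation y =
  [set cone y (fun a => s a) | s in [set s : 'S_n | realized fullv y (fun a => s a)]].
Proof.
apply/seteqP; split => [_ [v vA <-]|_ [s [v _ sv] <-]].
  have [s rs] := perm_ranking ((weyl_complementP _ _).1 vA).
  have sv : realizing y (fun a => s a) v by move=> a b; rewrite rs.
  exists s; first by exists v => //; rewrite memvf.
  by rewrite (component_realizing sv) closure_realizing//; exists v.
exists v; first exact: realizing_perm_complement sv.
by rewrite (component_realizing sv) closure_realizing//; exists v.
Qed.

End Cones.

(** * Faces of the Weyl chambers *)

Section Faces.
Variables (R : realType) (d n : nat) (y : 'I_n -> 'rV[R]_d).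
Implicit Types (p q : 'I_n -> nat) (s : 'S_n) (u v w x : 'rV[R]_d).

Lemma realizing_perturb p v u : realizing y p v -> u \in ties y p ->
  exists2 e, 0 < e & realizing y p (v + e *: u).
Proof.
move=> pv /tiesP up.
have [e e0 he] := perturb_lt y v u; exists e => // a b.
have lt_e i j : (p i < p j)%N -> inner (v + e *: u) (y i) < inner (v + e *: u) (y j).
  by rewrite -(realizing_lt _ _ pv) => /he.
case: (ltngtP (p a) (p b)) => [/lt_e/ltW//|/lt_e|ab]; first by rewrite ltNge => /negbTE.
have vab : inner v (y a) = inner v (y b).
  by apply/eqP; rewrite (realizing_eq _ _ pv) ab.
by rewrite !innerDl !innerZl vab (up a b) ?lexx.
Qed.

(** The linear hull of the cone is the whole space of vectors with the ties of
    [p], since these may be added in small amounts to the vector realizing [p]. *)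
Lemma has_dim_cone p w k : realizing y p w ->
  has_dim (cone y p) k <-> \dim (ties y p) = k.
Proof.
move=> pw.
have sub : cone y p `<=` [set` ties y p].
  move=> v pv /=; apply/tiesP => a b ab; apply/eqP; rewrite eq_le.
  by rewrite !pv ?ab.
have least (L : {vspace 'rV[R]_d}) : cone y p `<=` [set` L] -> (ties y p <= L)%VS.
  move=> cL; apply/subvP => u up.
  have [e e0 pe] := realizing_perturb pw up.
  have wL : w \in L by apply: cL; exact: realizing_cone.
  have weL : w + e *: u \in L by apply: cL; exact: realizing_cone.
  have := memvB weL wL; rewrite addrAC subrr add0r => /(memvZ e^-1).
  by rewrite scalerA mulVf ?gt_eqF// scale1r.
split=> [[L [cL Lmin <-]]|<-]; last by exists (ties y p).
by congr (\dim _); apply/subv_anti/andP; split; [exact: least|exact: Lmin].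
Qed.

(** In the description of the chamber by all comparisons of two points, the face
    is obtained by turning those of points on the same level into equations. *)
Lemma cone_is_face p s v w : realizing y (fun a => s a) v -> realizing y p w ->
  (forall a b, (s a <= s b)%N -> (p a <= p b)%N) ->
  is_face (cone y (fun a => s a)) (cone y p).
Proof.
move=> sv pw sp; pose D := [set ab : 'I_n * 'I_n | (s ab.1 < s ab.2)%N]%SET.
pose x (i : 'I_#|D|) := y (enum_val i).1 - y (enum_val i).2.
pose I := [set i : 'I_#|D| | p (enum_val i).1 == p (enum_val i).2]%SET.
have coneE : cone y (fun a => s a) = \bigcap_(i in [set: 'I_#|D|]) halfspace (x i).
  apply/seteqP; split => u su.
    move=> i _; rewrite /halfspace /= /x innerBr subr_le0; apply/su/ltnW.
    by have := enum_valP i; rewrite inE.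
  move=> a b; rewrite leq_eqVlt => /orP[/eqP/val_inj/perm_inj -> //|ab].
  have abD : (a, b) \in D by rewrite inE.
  have := su (enum_rank_in abD (a, b)) Logic.I.
  by rewrite /halfspace /= /x enum_rankK_in//= innerBr subr_le0.
exists #|D|, x, I; split => //.
  move=> i; apply/eqP => xi; have := enum_valP i; rewrite inE.
  by rewrite -(realizing_lt _ _ sv) -subr_lt0 -innerBr -/(x i) xi innerC inner0l ltxx.
apply/seteqP; split => u pu.
  move=> i _; have su : cone y (fun a => s a) u by move=> a b /sp/pu.
  case: ifPn => [|_]; last by move: su; rewrite coneE; apply.
  rewrite inE => /eqP ii; rewrite /perp /= /x innerBr; apply/eqP.
  by rewrite subr_eq0 eq_le !pu ?ii.
have su : cone y (fun a => s a) u.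
  rewrite coneE => i _; have := pu i Logic.I; case: ifP => // _.
  by rewrite /perp /halfspace /= => ->.
move=> a b; rewrite leq_eqVlt => /orP[/eqP ab|ab]; last first.
  by apply/su; rewrite leqNgt; apply/negP => /ltnW/sp; rewrite leqNgt ab.
suff tie i j : (s i < s j)%N -> p i = p j -> inner u (y i) = inner u (y j).
  have [sab|sab|/val_inj/perm_inj ->//] := ltngtP (s a) (s b); first by rewrite (tie a b).
  by rewrite (tie b a).
move=> ij pij; have ijD : (i, j) \in D by rewrite inE.
have := pu (enum_rank_in ijD (i, j)) Logic.I.
rewrite inE /= enum_rankK_in//= pij eqxx /perp /= /x enum_rankK_in//= innerBr.
by move/eqP; rewrite subr_eq0 => /eqP.
Qed.

(** A face of a chamber is determined by any of its points having the fewest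
    ties: this point lies in the relative interior, and a face is an extreme
    subset of the cone. *)
Lemma is_face_cone s F : is_face (cone y (fun a => s a)) F ->
  exists2 w, cone y (fun a => s a) w &
    F = [set v | forall a b, inner w (y a) <= inner w (y b) -> inner v (y a) <= inner v (y b)].
Proof.
set C := cone _ _; move=> [m [x [I [_ CE FE]]]].
have FP v : F v <-> C v /\ forall i, i \in I -> inner v (x i) = 0.
  rewrite FE CE; split=> [h|[h hI]] => [|i _]; last first.
    by case: ifPn => [/hI|_]//; apply: h.
  split=> [i _|i iI]; have := h i Logic.I; rewrite ?iI//.
  by case: ifP => // _; rewrite /perp /halfspace /= => ->.
have hC v i : C v -> inner v (x i) <= 0 by rewrite CE; apply.
have CD v w : C v -> C w -> C (v + w).
  by move=> cv cw; rewrite -[v]scale1r -[w]scale1r; apply: coneD.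
have FD v w : F v -> F w -> F (v + w).
  move=> /FP[cv hv] /FP[cw hw]; apply/FP; split; first exact: CD.
  by move=> i iI; rewrite innerDl hv// hw// addr0.
have extreme v w : C v -> C w -> F (v + w) -> F w.
  move=> cv cw /FP[_ h]; apply/FP; split=> // i iI; have := h i iI.
  by rewrite innerDl; have := hC v i cv; have := hC w i cw; lra.
pose T w := [set ab : 'I_n * 'I_n | inner w (y ab.1) == inner w (y ab.2)]%SET.
have ex : exists k, `[< exists2 w, F w & #|T w| = k >].
  exists #|T 0|; apply/asboolP; exists 0 => //; apply/FP.
  by split=> [a b|i] _; rewrite !inner0l.
case: (ex_minnP ex) => k /asboolP[w Fw wk] kmin.
have Cw : C w by case/FP: Fw.
exists w => //.
have tie_add v u a b : C v -> C u -> inner (v + u) (y a) = inner (v + u) (y b) ->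
    inner v (y a) = inner v (y b) /\ inner u (y a) = inner u (y b).
  move=> Cv Cu; rewrite !innerDl; have [ab|ab] := leqP (s a) (s b).
    by have := Cv _ _ ab; have := Cu _ _ ab; lra.
  by have := Cv _ _ (ltnW ab); have := Cu _ _ (ltnW ab); lra.
have Tmin v : F v -> forall a b, inner w (y a) = inner w (y b) -> inner v (y a) = inner v (y b).
  move=> Fv a b wab; have Cv : C v by case/FP: Fv.
  have Tsub : T (w + v) \subset T w.
    apply/fintype.subsetP => -[i j]; rewrite !inE /= => /eqP ij.
    by have [->] := tie_add _ _ _ _ Cw Cv ij.
  have TE : T (w + v) = T w.
    apply/eqP; rewrite eqEcard Tsub wk kmin//; apply/asboolP.
    by exists (w + v) => //; apply: FD.
  have : (a, b) \in T w by rewrite inE /= wab.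
  by rewrite -TE inE /= => /eqP /(tie_add _ _ _ _ Cw Cv)[].
apply/seteqP; split => v.
  move=> Fv a b; have Cv : C v by case/FP: Fv.
  rewrite le_eqVlt => /orP[/eqP/(Tmin v Fv) ->//|wab].
  by apply: Cv; rewrite leqNgt; apply/negP => /ltnW/Cw; rewrite leNgt wab.
move=> wv; have Cv : C v by move=> a b /Cw/wv.
have [e e0 he] := perturb_lt y w (- v).
have Cwe : C (w - e *: v).
  move=> a b ab; rewrite -scalerN.
  have := Cw a b ab; rewrite le_eqVlt => /orP[/eqP wab|/he/ltW//].
  have vab : inner v (y a) = inner v (y b) by apply/eqP; rewrite eq_le !wv ?wab.
  by rewrite !innerDl !innerZl !innerNl wab vab.
have Cev : C (e *: v) by move=> a b ab; rewrite !innerZl ler_pM2l// Cv.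
have : F (e *: v) by apply: (extreme (w - e *: v)) => //; rewrite subrK.
move=> /FP[_ h]; apply/FP; split=> // i /h; rewrite innerZl => /eqP.
by rewrite mulf_eq0 gt_eqF//= => /eqP.
Qed.

(** General position makes the dimension of a face depend only on the number of
    levels of its weak order. *)
Lemma faces_chamberE s m : in_general_position fullv y -> (d < n)%N -> (m < d)%N ->
  realized fullv y (fun a => s a) ->
  faces (d - m) (cone y (fun a => s a)) =
  [set cone y (fun a => p a) | p in [set p : {ffun 'I_n -> 'I_(n - m)} |
     [/\ onto p, refines s p & realized fullv y (fun a => p a)]]].
Proof.
move=> gp dn md [v _ sv].
have dimE (T : eqType) (p : 'I_n -> T) : \dim (ties y p) = (d - (n - nblocks p))%N.
  by have := gp_dim p gp; rewrite capfv dimv_rV.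
apply/seteqP; split => [F [/is_face_cone[w Cw ->] Fdim]|_ [p [/ontoP ps /refinesP sp [w _ pw]] <-]]; last first.
  split; first exact: cone_is_face sv pw sp.
  rewrite (has_dim_cone _ pw) dimE.
  have -> : nblocks (fun a => nat_of_ord (p a)) = nblocks p.
    by apply: (@nblocks_comp_inj _ _ _ p (fun i => nat_of_ord i)) => ? ? _ _ /val_inj.
  by rewrite (nblocks_onto ps); congr (d - _)%N; lia.
have [N NE] : exists N, nblocks (fun a => inner w (y a)) = N by eexists.
have [q [qw qs]] := ranking NE.
have qpw : realizing y (fun a => q a) w by move=> a b; rewrite qw.
have FE : [set v | forall a b, inner w (y a) <= inner w (y b) -> inner v (y a) <= inner v (y b)]
    = cone y (fun a => q a).
  by apply/seteqP; split => u uw a b; have := uw a b; rewrite /= qw.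
have nq : nblocks (fun a => nat_of_ord (q a)) = N.
  rewrite -[RHS](nblocks_onto qs).
  by apply: (@nblocks_comp_inj _ _ _ q (fun i => nat_of_ord i)) => ? ? _ _ /val_inj.
have := Fdim; rewrite FE (has_dim_cone _ qpw) dimE nq => dE.
have Nnm : N = (n - m)%N.
  by have := nblocks_le (fun a => inner w (y a)); rewrite NE; lia.
clear NE; subst N.
exists [ffun a => q a]; last by congr cone; apply/funext => a; rewrite ffunE.
split.
- by apply/ontoP => c; have [a <-] := qs c; exists a; rewrite ffunE.
- by apply/refinesP => a b ab; rewrite !ffunE qw; apply: Cw.
- by exists w; rewrite ?memvf// => a b; rewrite !ffunE qw.
Qed.

End Faces.

(** * Rotations and the moment curve *)

Section Rotations.
Variables (R : realType) (d : nat).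
Implicit Types (U V W : {vspace 'rV[R]_d}) (u v w x : 'rV[R]_d).

Definition orth V : {vspace 'rV[R]_d} := (\bigcap_(x <- vbasis V) hyp x)%VS.

Lemma mem_hyps (s : seq 'rV[R]_d) v :
  (v \in \bigcap_(x <- s) hyp x)%VS = all (fun x => inner v x == 0) s.
Proof.
by elim: s => [|x s IH]; rewrite ?big_nil ?memvf// big_cons memv_cap mem_hyp IH.
Qed.

Lemma orthP V v : reflect (forall u, u \in V -> inner u v = 0) (v \in orth V).
Proof.
rewrite /orth mem_hyps; apply: (iffP allP) => [vV u uV|h x xV]; last first.
  by rewrite innerC h// vbasis_mem.
have /subvP/(_ u uV) : (V <= hyp v)%VS.
  rewrite -(span_basis (vbasisP V)); apply/span_subvP => x /vV.
  by rewrite mem_hyp innerC.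
by rewrite mem_hyp => /eqP.
Qed.

Lemma add_orth V : (V + orth V)%VS = fullv.
Proof.
have cap0 : (V :&: orth V)%VS = 0%VS.
  apply/eqP; rewrite -subv0; apply/subvP => v; rewrite memv_cap memv0 => /andP[vV /orthP/(_ v vV)/eqP].
  by rewrite inner_sq_eq0.
have := dim_cap_hyps fullv (vbasis V); rewrite capfv -/(orth V) size_tuple => h.
by apply/eqP; rewrite eqEdim subvf /= dimv_disjoint_sum// addnC.
Qed.

Lemma proper_sub_hyp U : (\dim U < d)%N -> exists2 x, x != 0 & (U <= hyp x)%VS.
Proof.
move=> Ud; have o0 : orth U != 0%VS.
  apply/eqP => o0; have := add_orth U; rewrite o0 addv0 => UE.
  by move: Ud; rewrite UE dimv_rV ltnn.
exists (vpick (orth U)); first by rewrite vpick0.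
apply/subvP => u uU; rewrite mem_hyp; apply/eqP.
by have /orthP := memv_pick (orth U); apply.
Qed.

Lemma subspace_of_dim V m : (m <= \dim V)%N -> exists2 W, (W <= V)%VS & \dim W = m.
Proof.
move=> mV; exists <<take m (vbasis V)>>%VS.
  by apply/span_subvP => x /mem_take; apply: vbasis_mem.
have : free (take m (vbasis V)).
  have := basis_free (vbasisP V); rewrite -{1}(cat_take_drop m (vbasis V)).
  by move=> /catl_free h; exact: h.
by move/eqP => ->; rewrite size_takel// size_tuple.
Qed.

Definition moment (t : nat) : 'rV[R]_d := \row_i t%:R ^+ i.

(** The parameters of the points of the moment curve in a proper subspace are
    roots of the polynomial whose coefficients form a normal vector. *)
Lemma moment_sub_proper U (l : seq nat) : (\dim U < d)%N -> uniq l ->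
  {in l, forall t, moment t \in U} -> (size l < d)%N.
Proof.
move=> /proper_sub_hyp[x x0 Ux] ul lU.
pose p : {poly R} := \sum_(i < d) x 0 i *: 'X^i.
have pE : p = \poly_(i < d) (if insub i is Some j then x 0 j else 0).
  by rewrite poly_def; apply: eq_bigr => i _; rewrite valK.
have p0 : p != 0.
  apply: contraNneq x0 => p0; apply/eqP/rowP => i; rewrite mxE.
  by have := congr1 (coefp i) p0; rewrite /= pE coef_poly ltn_ord valK coef0.
have rl : all (root p) [seq t%:R | t <- l].
  apply/allP => _ /mapP[t tl ->]; rewrite rootE horner_sum.
  have := subvP Ux _ (lU t tl); rewrite mem_hyp innerC => /eqP h.
  by apply/eqP; rewrite -[RHS]h; apply: eq_bigr => i _; rewrite hornerZ hornerXn mxE.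
have := max_poly_roots p0 rl; rewrite map_inj_uniq ?ul; last first.
  by move=> a b /eqP; rewrite eqr_nat => /eqP.
move=> /(_ isT); rewrite size_map => /leq_trans; apply.
by rewrite pE size_poly.
Qed.

(** Two factorizations of the same block matrix, eliminating either block. *)
Lemma det_rank1 (x y : 'rV[R]_d) : \det (1%:M - x^T *m y) = 1 - inner y x.
Proof.
have E1 : block_mx (1%:M : 'M[R]_1) y x^T 1%:M =
    block_mx 1%:M 0 x^T 1%:M *m block_mx 1%:M y 0 (1%:M - x^T *m y).
  by rewrite mulmx_block !mul1mx ?mulmx1 ?mul0mx ?mulmx0 ?addr0 ?add0r subrKC.
have E2 : block_mx (1%:M : 'M[R]_1) y x^T 1%:M =
    block_mx 1%:M y 0 1%:M *m block_mx (1%:M - y *m x^T) 0 x^T 1%:M.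
  by rewrite mulmx_block !mul1mx ?mulmx1 ?mul0mx ?mulmx0 ?add0r ?addr0 subrK.
have : \det (block_mx (1%:M : 'M[R]_1) y x^T 1%:M) = 1 - inner y x.
  rewrite E2 det_mulmx det_ublock det_lblock !det1 !mul1r mulr1.
  by rewrite det_mx11 !mxE eqxx innerE mxE.
by rewrite E1 det_mulmx det_lblock det_ublock !det1 !mul1r.
Qed.

(** The Householder matrix of the hyperplane orthogonal to [x], acting on row
    vectors from the right. *)
Definition reflection x : 'M[R]_d := 1%:M - x^T *m ((2 / inner x x) *: x).

Lemma reflectionE x v : v *m reflection x = v - (2 * inner v x / inner x x) *: x.
Proof.
rewrite mulmxBr mulmx1 mulmxA; congr (_ - _).
rewrite [v *m x^T]mx11_scalar -innerE mul_scalar_mx scalerA; congr (_ *: _).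
by rewrite mulrA [_ * 2]mulrC.
Qed.

Lemma inner_sq_neq0 x : x != 0 -> inner x x != 0.
Proof. by rewrite inner_sq_eq0. Qed.

Lemma det_reflection x : x != 0 -> \det (reflection x) = -1.
Proof.
move=> x0; rewrite det_rank1 innerZl divfK ?inner_sq_neq0//; lra.
Qed.

Lemma reflection_orthogonal x : x != 0 -> reflection x *m (reflection x)^T = 1%:M.
Proof.
move=> x0; apply/row_matrixP => i; rewrite !rowE mulmx1 mulmxA.
have -> : (reflection x)^T = reflection x.
  rewrite /reflection linearB /= trmx1 trmx_mul trmxK linearZ /=.
  by rewrite -scalemxAr -scalemxAl.
set v := delta_mx 0 i; rewrite !reflectionE innerBl innerZl.
rewrite divfK ?inner_sq_neq0// -addrA -opprD -scalerDl.
have -> : 2 * inner v x / inner x x + 2 * (inner v x - 2 * inner v x) / inner x x = 0.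
  by field; exact: inner_sq_neq0.
by rewrite scale0r subr0.
Qed.

Lemma rotateE (Q : 'M[R]_d) V v : Q *m Q^T = 1%:M ->
  (v *m Q \in rotate Q V) = (v \in V).
Proof.
move=> QQ; rewrite /rotate; apply/memv_imgP/idP => [[u uV]|vV].
  rewrite lfunE /= => /(congr1 (mulmx^~ Q^T)); rewrite -!mulmxA QQ !mulmx1.
  by move=> ->.
by exists v => //; rewrite lfunE.
Qed.

Lemma rotate_line (Q : 'M[R]_d) W v : {in W, forall w, w *m Q = w} ->
  rotate Q (W + <[v]>) = (W + <[v *m Q]>)%VS.
Proof.
move=> QW; rewrite /rotate limgD limg_line lfunE /=; congr (_ + _)%VS.
rewrite -[RHS](lim1g W); apply: eq_in_limg => w wW.
by rewrite lfunE /= id_lfunE QW.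
Qed.

Lemma rotate_mul (P Q : 'M[R]_d) V : rotate (P *m Q) V = rotate Q (rotate P V).
Proof.
rewrite /rotate -limg_comp; apply: eq_in_limg => v _.
by rewrite comp_lfunE !lfunE /= mulmxA.
Qed.

(** Rotations fixing [W] act transitively on the subspaces containing [W] as a
    hyperplane: a reflection maps one line orthogonal to [W] to the other, and
    the reflection reversing the second line restores the orientation. *)
Lemma rotation_between W v1 v2 : v1 \notin W -> v2 \notin W ->
  exists Q : 'M[R]_d, [/\ Q *m Q^T = 1%:M, \det Q = 1 &
    rotate Q (W + <[v1]>) = (W + <[v2]>)%VS].
Proof.
have dec v : v \notin W -> exists u, [/\ u != 0, u \in orth W & (W + <[v]> = W + <[u]>)%VS].
  move=> vW; have : v \in (W + orth W)%VS by rewrite add_orth memvf.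
  move=> /memv_addP[w wW [u uo vE]]; exists u; split => //.
    by apply: contraNneq vW => u0; rewrite vE u0 addr0.
  apply/subv_anti/andP; split; rewrite subv_add addvSl /= -memvE.
    by rewrite vE memv_add// memv_line.
  have -> : u = - w + v by rewrite vE addKr.
  by rewrite memv_add ?memvN// memv_line.
move=> /dec[u1 [u1n0 u1o ->]] /dec[u2' [u2n0 u2o' ->]].
have pos u : u != 0 -> 0 < inner u u.
  move=> u0; rewrite lt_neqAle eq_sym inner_sq_neq0//=.
  by apply: sumr_ge0 => i _; rewrite -expr2 sqr_ge0.
pose c := Num.sqrt (inner u1 u1 / inner u2' u2').
have c0 : c != 0 by rewrite gt_eqF// sqrtr_gt0 divr_gt0 ?pos.
pose u2 := c *: u2'.
have -> : (W + <[u2']> = W + <[u2]>)%VS.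
  apply/subv_anti/andP; split; rewrite subv_add addvSl /= -memvE.
    have -> : u2' = 0 + c^-1 *: u2 by rewrite add0r scalerA mulVf// scale1r.
    by rewrite memv_add ?mem0v// memvZ// memv_line.
  by rewrite -[u2]add0r memv_add ?mem0v// memvZ// memv_line.
have u2o : u2 \in orth W by rewrite memvZ.
have u20 : u2 != 0 by rewrite scaler_eq0 negb_or c0.
have nE : inner u2 u2 = inner u1 u1.
  rewrite /u2 innerZl innerC innerZl mulrA -expr2 sqr_sqrtr ?divfK ?inner_sq_neq0//.
  by rewrite ltW// divr_gt0 ?pos.
have [u12|u12] := eqVneq u1 u2.
  exists 1%:M; rewrite trmx1 mulmx1 det1; split => //.
  by rewrite rotate_line ?mulmx1 ?u12// => w _; rewrite mulmx1.
pose x := u1 - u2; have x0 : x != 0 by rewrite subr_eq0.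
have xo : x \in orth W by rewrite memvB.
have fixW z : z \in orth W -> {in W, forall w, w *m reflection z = w}.
  move=> /orthP zo w wW; rewrite reflectionE zo// mulr0 mul0r scale0r subr0 //.
exists (reflection x *m reflection u2); split.
- rewrite trmx_mul mulmxA -(mulmxA (reflection x)) reflection_orthogonal// mulmx1.
  by rewrite reflection_orthogonal.
- by rewrite det_mulmx !det_reflection// mulrNN mulr1.
- rewrite rotate_mul rotate_line; last exact: fixW.
  have -> : u1 *m reflection x = u2.
    rewrite reflectionE.
    have -> : 2 * inner u1 x / inner x x = 1.
      have xx : inner x x = 2 * inner u1 x.
        by rewrite /x innerBl !innerBr nE (innerC u2 u1); lra.
      by rewrite xx divff// -xx inner_sq_neq0.
    by rewrite scale1r /x opprB subrKC.
  rewrite rotate_line; last exact: fixW.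
  have -> : u2 *m reflection u2 = - u2.
    by rewrite reflectionE mulfK ?inner_sq_neq0// scaler_nat mulr2n opprD addrA subrr sub0r.
  apply/subv_anti/andP; split; rewrite subv_add addvSl /= -memvE.
    by rewrite -[- u2]add0r memv_add ?mem0v// -scaleN1r memvZ ?memv_line.
  have h : u2 \in <[- u2]>%VS.
    by have := memvZ (-1) (memv_line (- u2)); rewrite scaleN1r opprK.
  by rewrite -{1}[u2]add0r memv_add ?mem0v.
Qed.

End Rotations.

(** * Measurability of hitting events *)

Section Hitting.
Variables (R : realType) (d : nat).
Implicit Types (U V W : {vspace 'rV[R]_d}) (C : set 'rV[R]_d).

Lemma mx_continuous (T : topologicalType) m n (f : T -> 'M[R]_(m, n)) :
  (forall i j, continuous (fun t => f t i j)) -> continuous f.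
Proof.
move=> fc t P [Q Qn QP]; apply: (@filterS _ _ _ [set t' | forall i j, Q i j (f t' i j)]).
  by move=> t' h; apply: QP.
apply: filter_forall => i; apply: filter_forall => j.
exact: fc (Qn i j).
Qed.

Lemma mulmx_continuous m :
  continuous (fun aM : 'rV[R]_m * 'M[R]_(m, d) => aM.1 *m aM.2).
Proof.
apply: mx_continuous => i j.
have h (r : seq 'I_m) : continuous (fun aM : 'rV[R]_m * 'M[R]_(m, d) => \sum_(k <- r) aM.1 i k * aM.2 k j).
  elim: r => [|k r IH].
    have -> : (fun aM : 'rV[R]_m * 'M[R]_(m, d) => \sum_(k <- [::]) aM.1 i k * aM.2 k j) = cst 0.
      by apply/funext => v; rewrite big_nil.
    exact: cst_continuous.
  have -> : (fun aM : 'rV[R]_m * 'M[R]_(m, d) => \sum_(l <- k :: r) aM.1 i l * aM.2 l j) =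
      (fun aM => aM.1 i k * aM.2 k j + \sum_(l <- r) aM.1 i l * aM.2 l j).
    by apply/funext => v; rewrite big_cons.
  move=> v; apply: (@continuousD _ _ ('rV[R]_m * 'M[R]_(m, d))%type); last exact: IH.
  apply: (@continuousM _ ('rV[R]_m * 'M[R]_(m, d))%type).
    apply: (@continuous_comp _ _ _ fst (fun M : 'rV[R]_m => M i k)); first exact: cvg_fst.
    exact: coord_continuous.
  apply: (@continuous_comp _ _ _ snd (fun M : 'M[R]_(m, d) => M k j)); first exact: cvg_snd.
  exact: coord_continuous.
have -> : (fun t : 'rV[R]_m * 'M[R]_(m, d) => (t.1 *m t.2) i j) = (fun t => \sum_k t.1 i k * t.2 k j).
  by apply/funext => t; rewrite mxE.
exact: h.
Qed.

Lemma row_spaceP m (M : 'M[R]_(m, d)) v :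
  reflect (exists a : 'rV_m, v = a *m M) (v \in row_space M).
Proof.
apply: (iffP idP) => [|[a ->]].
  have : (row_space M <= limg (linfun (mulmxr M : 'rV[R]_m -> 'rV[R]_d)))%VS.
    apply/span_subvP => _ /mapP[i _ ->]; rewrite rowE.
    by have := memv_img (linfun (mulmxr M : 'rV[R]_m -> 'rV[R]_d)) (memvf (delta_mx 0 i)); rewrite lfunE.
  by move=> /subvP h /h /memv_imgP[a _ ->]; exists a; rewrite lfunE.
rewrite mulmx_sum_row memv_suml// => i _; apply: memvZ; apply: memv_span.
by apply: map_f; rewrite mem_enum.
Qed.

Lemma row_freeP m (M : 'M[R]_(m, d)) :
  reflect (forall a : 'rV_m, a *m M = 0 -> a = 0) (row_free M).
Proof.
apply: (iffP idP) => [fM a /eqP|]; last exact: inj_row_free.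
by rewrite mulmx_free_eq0// => /eqP.
Qed.

Lemma sphere_compact m : compact [set a : 'rV[R]_m | `|a| = 1].
Proof.
apply: bounded_closed_compact.
  by exists 1; split=> // r r1 a /= ->; rewrite ltW.
have -> : [set a : 'rV[R]_m | `|a| = 1] = (fun a => `|a|) @^-1` [set 1] by [].
apply: preimage_closed => [a _|]; first exact: norm_continuous.
exact: accessible_closed_set1 (hausdorff_accessible (@norm_hausdorff _ _)) _.
Qed.

(** The cones for which hitting a subspace is a measurable event. *)
Definition closed_cone C :=
  [/\ closed C, C 0 & forall a v, 0 < a -> C v -> C (a *: v)].

Definition hits C : set (subspaces R d) :=
  [set L : {vspace 'rV[R]_d} | C `&` [set` L] != [set 0]].

Lemma hitsP C L : C 0 -> hits C L <-> exists v, [/\ C v, v \in (L : {vspace 'rV[R]_d}) & v != 0].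
Proof.
move=> C0; split=> [h|[v [Cv vL v0]]].
  apply: contrapT => hn; move/eqP: h; apply; apply/seteqP; split => [v [Cv vL]|_ ->].
    by apply: contrapT => /eqP v0; apply: hn; exists v.
  by split=> //=; rewrite mem0v.
apply/eqP => E; move/eqP: v0; apply.
by have : (C `&` [set` (L : {vspace 'rV[R]_d})]) v by []; rewrite E.
Qed.

(** The unit sphere is compact, so missing a closed set is stable under small
    changes of the matrix. *)
Lemma open_miss C m : closed C -> open [set M : 'M[R]_(m, d) | forall a : 'rV_m, `|a| = 1 -> ~ C (a *m M)].
Proof.
move=> Cc; rewrite openE => M hM; rewrite /interior.
have /compact_near_coveringP cov := @sphere_compact m.
have := cov _ (nbhs M) (fun M' a => ~ C (a *m M')) _; apply => a a1.
have : open (~` C) by exact: closed_openC.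
rewrite openE => /(_ (a *m M) (hM a a1)) nC.
exact: (@mulmx_continuous m (a, M)) nC.
Qed.

Lemma unit_miss C m (M : 'M[R]_(m, d)) : (forall a v, 0 < a -> C v -> C (a *: v)) ->
  (forall a : 'rV_m, `|a| = 1 -> ~ C (a *m M)) -> forall a : 'rV_m, a != 0 -> ~ C (a *m M).
Proof.
move=> Cs h a a0 Ca; apply: (h (`|a|^-1 *: a)).
  by rewrite normrZ normfV normr_id mulVf// normr_eq0.
by rewrite -scalemxAl; apply: Cs => //; rewrite invr_gt0 normr_gt0.
Qed.

Lemma unit_neq0 m (a : 'rV[R]_m) : `|a| = 1 -> a != 0.
Proof. by move=> a1; rewrite -normr_eq0 a1 oner_eq0. Qed.

(** A subspace misses a cone outside of [0] when the unit combinations of a basis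
    do, by homogeneity. *)
Lemma measurable_hits C : closed_cone C -> measurable (hits C).
Proof.
move=> [Cc C0 Cs]; rewrite -[hits C]setCK; apply: measurableC.
apply: sub_sigma_algebra => m.
rewrite (_ : [set M | _] = [set M | forall a : 'rV_m, `|a| = 1 -> ~ C (a *m M)]); first exact: open_miss.
apply/seteqP; split => M /=.
  move=> [/row_freeP fM hM] a /unit_neq0 a0 Ca; apply: hM; apply/hitsP => //.
  exists (a *m M); split => //; first by apply/row_spaceP; exists a.
  by apply: contra_neq a0; apply: fM.
move=> /(unit_miss Cs) hn; split.
  by apply/row_freeP => a aM; apply: contrapT => /eqP/hn; apply; rewrite aM.
move=> /hitsP -/(_ C0)[v [Cv /row_spaceP[a va]]]; rewrite {}va in Cv *.
by have [->|/hn/(_ Cv)] := eqVneq a 0; rewrite ?mul0mx ?eqxx.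
Qed.

Lemma dim_row_space m (M : 'M[R]_(m, d)) : row_free M -> \dim (row_space M) = m.
Proof.
move=> /row_freeP fM.
have -> : row_space M = limg (linfun (mulmxr M : 'rV[R]_m -> 'rV[R]_d)).
  apply/vspaceP => v; apply/row_spaceP/memv_imgP => [[a ->]|[a _ ->]]; exists a;
    by rewrite ?memvf ?lfunE.
rewrite limg_dim_eq ?dimv_rV//; apply/eqP; rewrite -subv0; apply/subvP => a.
by rewrite memv_cap memv_ker lfunE /= => /andP[_ /eqP/fM ->]; rewrite mem0v.
Qed.

Lemma measurable_grassmannian m : measurable (@grassmannian R d m).
Proof.
apply: sub_sigma_algebra => k.
have [<-|km] := eqVneq k m; last first.
  rewrite (_ : [set M | _] = set0); first exact: open0.
  apply/seteqP; split=> // M [/dim_row_space]; rewrite /grassmannian /= => -> /eqP.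
  by rewrite (negPf km).
rewrite (_ : [set M | _] = [set M : 'M[R]_(k, d) | forall a : 'rV_k, `|a| = 1 -> ~ [set 0] (a *m M)]).
  apply: open_miss; exact: accessible_closed_set1 (hausdorff_accessible (@norm_hausdorff _ _)) _.
apply/seteqP; split => M /=.
  by move=> [/row_freeP fM _] a /unit_neq0 a0 /fM; apply/eqP.
move=> h; have fM : row_free M.
  apply/row_freeP => a aM; apply: contrapT => /eqP a0.
  apply: (@unit_miss [set 0] _ M _ h a a0) => // c v _ /= ->; by rewrite scaler0.
by split => //; exact: dim_row_space.
Qed.

Lemma vspace_closed_cone V : closed_cone [set` V].
Proof.
split => [||a v _ /=]; [|by rewrite /= mem0v|by move=> ?; rewrite memvZ].
pose f : 'rV[R]_d -> 'rV[R]_d := fun v => v - projv V v.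
pose x j : 'rV[R]_d := \row_i f (delta_mx 0 i) 0 j.
have fE v j : f v 0 j = inner v (x j).
  rewrite {1}[v]row_sum_delta /f linear_sum -sumrB summxE; apply: eq_bigr => i _.
  by rewrite linearZ -scalerBr !mxE.
have -> : [set` V] = \bigcap_(j in [set: 'I_d]) ((fun v => inner v (x j)) @^-1` [set 0]).
  apply/seteqP; split => v /= vV.
    by move=> j _; rewrite /= -fE /f projv_id// subrr mxE.
  have : f v = 0 by apply/rowP => j; rewrite fE mxE vV.
  by rewrite /f => /subr0_eq ->; exact: memv_proj.
apply: closed_bigI => j _; apply: preimage_closed => [v _|]; first exact: inner_continuous.
exact: accessible_closed_set1 (hausdorff_accessible (@norm_hausdorff _ _)) _.
Qed.

Lemma cone_closed_cone n (y : 'I_n -> 'rV[R]_d) p : closed_cone (cone y p).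
Proof.
split; [exact: cone_closed|by move=> a b _; rewrite !inner0l|].
by move=> a v a0 pv i j ij; rewrite !innerZl ler_pM2l// pv.
Qed.

End Hitting.

(** * Expected numbers of events *)

Section Counting.
Variables (R : realType) (dsp : measure_display) (T : measurableType dsp).
Variable P : probability T R.

Lemma integral_cst_probability (c : \bar R) : (\int[P]_x cst c x = c)%E.
Proof.
by rewrite integral_cst// -[RHS]mule1; congr (_ * _)%E; exact: probability_setT.
Qed.

Lemma sum_probability (I : eqType) (l : seq I) (A : I -> set T) :
  (forall i, measurable (A i)) ->
  (\sum_(i <- l) P (A i) = \int[P]_x (count (fun i => `[< A i x >]) l)%:R%:E)%E.
Proof.
move=> mA; have mi i : measurable_fun [set: T] (EFin \o (\1_(A i) : T -> R)).
  by apply/measurable_EFinP; exact: measurable_indic.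
have -> : (fun x => (count (fun i => `[< A i x >]) l)%:R%:E) =
    (fun x => \sum_(i <- l) (\1_(A i) x : R)%:E)%E.
  apply/funext => x; rewrite sumEFin; congr _%:E.
  elim: l => [|i l IH] /=; first by rewrite big_nil.
  by rewrite big_cons -IH natrD indicE.
rewrite ge0_integral_sum//.
by apply: eq_bigr => i _; rewrite integral_indic// setIT.
Qed.

Lemma measurable_count (I : eqType) (l : seq I) (A : I -> set T) :
  (forall i, measurable (A i)) ->
  measurable_fun [set: T] (fun x => (count (fun i => `[< A i x >]) l)%:R%:E : \bar R).
Proof.
move=> mA; apply/measurable_EFinP.
have -> : (fun x => (count (fun i => `[< A i x >]) l)%:R) =
    (fun x => \sum_(i <- l) (\1_(A i) x : R)).
  apply/funext => x; elim: l => [|i l IH] /=; first by rewrite big_nil.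
  by rewrite big_cons -IH natrD indicE.
by apply: measurable_sum => i; exact: measurable_indic.
Qed.

Lemma sum_probability_le (I : eqType) (l : seq I) (A : I -> set T) (c : nat) :
  (forall i, measurable (A i)) ->
  (\forall x \ae P, (count (fun i => `[< A i x >]) l <= c)%N) ->
  (\sum_(i <- l) P (A i) <= c%:R%:E)%E.
Proof.
move=> mA Ac; rewrite sum_probability//.
have -> : (c%:R%:E = \int[P]_x (cst c%:R%:E x : \bar R))%E.
  by rewrite integral_cst_probability.
apply: ae_ge0_le_integral => //; first exact: measurable_count.
  by move=> x _; rewrite lee_fin.
by apply: filterS Ac => x cx _; rewrite lee_fin ler_nat.
Qed.

Lemma sum_probability_eq (I : eqType) (l : seq I) (A : I -> set T) (c : R) :
  (forall i, measurable (A i)) ->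
  (\forall x \ae P, (count (fun i => `[< A i x >]) l)%:R = c) ->
  (\sum_(i <- l) P (A i) = c%:E)%E.
Proof.
move=> mA Ac; rewrite sum_probability// -[RHS]integral_cst_probability.
apply: ae_eq_integral => //; first exact: measurable_count.
by apply: filterS Ac => x cx _; rewrite cx.
Qed.

(** The integral of a non-negative function that is almost everywhere constant,
    when the function may fail to be measurable on the exceptional set: the
    simple functions below it are those below the constant, up to a null set. *)
Lemma expectation_ae_cst (f : T -> R) (c : R) : 0 <= c -> (forall x, 0 <= f x) ->
  (\forall x \ae P, f x = c) -> ('E_P[f] = c%:E)%E.
Proof.
move=> c0 f0 [N [mN PN fN]].
have mono (g h : T -> \bar R) : (forall x, 0 <= g x)%E -> (forall x, g x <= h x)%E ->
    (\int[P]_x g x <= \int[P]_x h x)%E.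
  move=> g0 gh; rewrite !ge0_integralTE//; last by move=> x; exact: le_trans (g0 x) (gh x).
  by apply: le_ereal_sup => _ [u /= ug <-]; exists u => //= x; exact: le_trans (ug x) (gh x).
have Nae : \forall x \ae P, ~ N x.
  by exists N; split => // x /= /contrapT.
have intE (b : \bar R) : (0 <= b)%E -> (\int[P]_x (if x \in N then b else c%:E) = c%:E)%E.
  move=> b0; transitivity (\int[P]_x (cst c%:E x))%E; last first.
    by rewrite integral_cst_probability.
  apply: ae_eq_integral => //.
    apply: measurable_fun_ifT => //.
    apply: (@measurable_fun_bool _ _ _ _ true).
    rewrite setTI (_ : _ @^-1` _ = N)//.
    by apply/seteqP; split => x /=; [exact: set_mem|exact: mem_set].
  by apply: filterS Nae => x /= nx _; rewrite ifF//; apply/negbTE; rewrite notin_setE.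
rewrite unlock; apply/eqP; rewrite eq_le; apply/andP; split.
  rewrite -(intE +oo%E)//; apply: mono => x; first by rewrite lee_fin.
  case: ifPn => [_|]; first exact: leey.
  rewrite notin_setE => Nx; have -> // : f x = c.
  by apply: contrapT => fx; apply: Nx; exact: fN.
rewrite -(intE 0%E)//; apply: mono => x; case: ifPn => [_|]; rewrite ?lee_fin//.
rewrite notin_setE => Nx; have -> // : f x = c.
by apply: contrapT => fx; apply: Nx; exact: fN.
Qed.

End Counting.

(** * Random subspaces are in general position *)

Section GenericSubspace.
Variables (R : realType) (d k : nat) (nu : probability (subspaces R d) R).
Hypothesis hnu : grassmann_measure k nu.
Implicit Types (U V W : {vspace 'rV[R]_d}).

Lemma ae_grassmannian : \forall L \ae nu, \dim (L : {vspace 'rV[R]_d}) = k.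
Proof.
have [nuG _] := hnu; have mG := measurable_grassmannian (R:=R) (d:=d) k.
exists (~` @grassmannian R d k); split => //; first exact: measurableC.
by rewrite probability_setC// nuG subee.
Qed.

Notation hitV V := (hits [set` V]).

Lemma measurable_hitV V : measurable (hitV V).
Proof. by apply: measurable_hits; exact: vspace_closed_cone. Qed.

Lemma hitVP V (L : subspaces R d) :
  hitV V L <-> exists v, [/\ v \in V, v \in (L : {vspace 'rV[R]_d}) & v != 0].
Proof. by apply: hitsP; rewrite /= mem0v. Qed.

Lemma hitV_rotate V (Q : 'M[R]_d) : Q *m Q^T = 1%:M -> \det Q = 1 ->
  nu (hitV (rotate Q V)) = nu (hitV V).
Proof.
move=> QQ dQ; rewrite -[LHS](hnu.2 Q QQ dQ); last exact: measurable_hitV.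
congr (nu _); apply/seteqP; split => L /=.
  move=> /hitVP[v [vV vL v0]]; apply/hitVP.
  have Qv : v = v *m Q^T *m Q by rewrite -mulmxA (mulmx1C QQ) mulmx1.
  exists (v *m Q^T); split.
  - by rewrite -(rotateE V _ QQ) -Qv.
  - by rewrite -(rotateE _ _ QQ) -Qv.
  - by apply: contra_neq v0 => h; rewrite Qv h mul0mx.
move=> /hitVP[v [vV vL v0]]; apply/hitVP; exists (v *m Q); split.
- by rewrite rotateE.
- by rewrite rotateE.
- by apply: contra_neq v0 => h; rewrite -[v]mulmx1 -QQ mulmxA h mul0mx.
Qed.

(** A random subspace misses a fixed subspace of complementary dimension.
    By induction, it misses a hyperplane [W] of this subspace.  If it hit the
    subspace with positive probability, it would hit with the same probability
    every subspace spanned by [W] and a point of the moment curve outside of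
    [W].  But if [L] misses [W], then [L + W] is proper, and [L] hits fewer than [d] of these. *)
Lemma hitV_null V : (\dim V + k <= d)%N -> nu (hitV V) = 0%E.
Proof.
have [e] := ubnP (\dim V); elim: e V => // e IH V; rewrite ltnS leq_eqVlt => /orP[/eqP Ve|]; last exact: IH.
move=> Vkd; case: e => [|e] in IH Ve *.
  rewrite (_ : hitV V = set0) ?measure0//; apply/seteqP; split => // L /hitVP[v [vV _]].
  by move/eqP: Ve; rewrite dimv_eq0 => /eqP V0; rewrite V0 memv0 in vV; rewrite vV.
have [W WV We] : exists2 W, (W <= V)%VS & \dim W = e by apply: subspace_of_dim; rewrite Ve.
have [v vV vW] : exists2 v, v \in V & v \notin W.
  have /subvPn[v ? ?] : ~~ (V <= W)%VS; last by exists v.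
  by apply/negP => /dimvS; rewrite We Ve ltnn.
have dimW u : u \notin W -> \dim (W + <[u]>) = e.+1.
  move=> uW; rewrite dimv_disjoint_sum ?We ?dim_vline ?addn1//.
    by case: eqP uW => [->|_ _]; rewrite ?mem0v// addn1.
  apply/eqP; rewrite -subv0; apply/subvP => x; rewrite memv_cap => /andP[xW /vlineP[c xE]].
  rewrite memv0 xE; have [->|c0] := eqVneq c 0; first by rewrite scale0r.
  have := memvZ c^-1 xW; rewrite xE scalerA mulVf// scale1r.
  by rewrite (negPf uW).
have VE : V = (W + <[v]>)%VS.
  apply/eqP; rewrite eq_sym eqEdim Ve dimW// leqnn andbT subv_add WV /=.
  by rewrite -memvE.
have same u : u \notin W -> nu (hitV (W + <[u]>)%VS) = nu (hitV V).
  move=> uW; have [Q [QQ dQ <-]] := rotation_between vW uW.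
  by rewrite hitV_rotate// -VE.
have W0 : nu (hitV W) = 0%E by apply: IH; rewrite ?We//; lia.
have WN : \forall L \ae nu, ~ hitV W L.
  exists (hitV W); split => //; first exact: measurable_hitV.
  by move=> L /= /contrapT.
have aE : nu (hitV V) = (fine (nu (hitV V)))%:E by rewrite fineK// fin_num_measure//; exact: measurable_hitV.
set a := fine _ in aE.
have a0 : 0 <= a by rewrite fine_ge0.
have bound M : a * M%:R <= d%:R.
  pose l := [seq t <- iota 0 (M + d) | moment R d t \notin W].
  have lM : (M <= size l)%N.
    have : (size [seq t <- iota 0 (M + d) | moment R d t \in W] <= d)%N.
      apply/ltnW/(@moment_sub_proper _ _ W); first by rewrite We; lia.
        by rewrite filter_uniq// iota_uniq.
      by move=> t; rewrite mem_filter => /andP[].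
    have := count_predC (fun t => moment R d t \in W) (iota 0 (M + d)).
    rewrite size_iota /l !size_filter.
    rewrite (_ : count (predC _) _ = count (fun t => moment R d t \notin W) (iota 0 (M + d)))//.
    by move: (count _ _) (count _ _) => a1 a2; lia.
  have := @sum_probability_le _ _ _ nu _ l (fun t => hitV (W + <[moment R d t]>)%VS) d.
  move=> /(_ (fun t => measurable_hitV _)) h.
  have {h} : (\sum_(i <- l) nu (hitV (W + <[moment R d i]>)%VS) <= d%:R%:E)%E.
    apply: h; near=> L.
    have Lk : \dim (L : {vspace 'rV[R]_d}) = k by near: L; exact: ae_grassmannian.
    have LW : ~ hitV W L by near: L.
    rewrite -size_filter; apply/ltnW/(@moment_sub_proper _ _ ((L : {vspace 'rV[R]_d}) + W)%VS).
    - by rewrite (leq_ltn_trans (dimv_add_leqif _ _))// Lk We; lia.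
    - by rewrite !filter_uniq// iota_uniq.
    move=> t; rewrite mem_filter => /andP[/asboolP/hitVP[u [uWt uL u0]] _].
    move: uWt => /memv_addP[w wW [_ /vlineP[c ->] uE]].
    have c0 : c != 0.
      apply/eqP => c0; apply: LW; apply/hitVP; exists u; split => //.
      by rewrite uE c0 scale0r addr0.
    have -> : moment R d t = c^-1 *: u + (- c^-1) *: w.
      by rewrite uE scalerDr scalerA mulVf// scale1r scaleNr addrAC subrr add0r.
    by rewrite memv_add// memvZ.
  rewrite big_seq (eq_bigr (fun=> a%:E)) => [|t]; last first.
    by rewrite mem_filter => /andP[/same -> _].
  rewrite -big_seq sumEFin lee_fin big_const_seq count_predT iter_addr addr0 => h.
  by apply: (le_trans _ h); rewrite mulr_natr; apply: ler_wpMn2l.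
have [a00|an0] := eqVneq a 0; first by rewrite aE a00.
have apos : 0 < a by rewrite lt_neqAle eq_sym an0.
have := bound (Num.bound (d%:R / a)).+1; rewrite leNgt => /negP[].
rewrite mulrC -ltr_pdivrMr//; apply: lt_le_trans (archi_boundP _) _.
  by rewrite divr_ge0// ler0n.
by rewrite ler_nat.
Unshelve. all: by end_near. Qed.

(** Almost every subspace inherits the general position of the points, since
    it is transversal to each of the finitely many subspaces of ties. *)
Lemma ae_general_position n (y : 'I_n -> 'rV[R]_d) : (k <= d)%N ->
  in_general_position fullv y ->
  \forall L \ae nu, \dim (L : {vspace 'rV[R]_d}) = k /\
    in_general_position (L : {vspace 'rV[R]_d}) y.
Proof.
move=> kd gp.
have mis (p : {ffun 'I_n -> 'I_n}) : exists V, [/\ (V <= ties y p)%VS,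
    (\dim V + k <= d)%N & (\dim (ties y p) <= \dim V + (\dim (ties y p) + k - d))%N].
  have [V VT dV] : exists2 V, (V <= ties y p)%VS & \dim V = minn (\dim (ties y p)) (d - k).
    by apply: subspace_of_dim; rewrite geq_minl.
  by exists V; split => //; rewrite dV; lia.
pose V p := sval (cid (mis p)).
have VP p := svalP (cid (mis p)).
have ae1 : \forall L \ae nu, forall p, ~ hitV (V p) L.
  apply: filter_forall => p; exists (hitV (V p)); split.
  - exact: measurable_hitV.
  - by apply: hitV_null; case: (VP p).
  - by move=> L /= /contrapT.
have FF : Filter (nbhs (almost_everywhere nu)) := ae_filter_ringOfSetsType nu.
near=> L.
have Lk : \dim (L : {vspace 'rV[R]_d}) = k by near: L; exact: ae_grassmannian.
split=> // q; have : forall p, ~ hitV (V p) L by near: L.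
pose p := [ffun a => q a]; move=> /(_ p) hp.
have pq : ties y p = ties y q by apply: eq_ties => a b; rewrite !ffunE.
have [VT Vk Vd] := VP p; rewrite -/(V p) pq in VT Vk Vd.
have dT : \dim (ties y q) = (d - (n - nblocks q))%N by have := gp_dim q gp; rewrite capfv dimv_rV.
have dadd U (X : {vspace 'rV[R]_d}) : (\dim (U :&: X) + \dim (U + X) = \dim U + \dim X)%N.
  by rewrite addnC dimv_sum_cap.
have cap0 : \dim (L :&: ties y q :&: V p)%VS = 0%N.
  apply/eqP; rewrite dimv_eq0 -subv0; apply/subvP => v; rewrite !memv_cap memv0.
  move=> /andP[/andP[vL _] vV]; apply: contrapT => v0; apply: hp; apply/hitVP.
  by exists v; split => //; apply/negP.
have h1 := dadd (L : {vspace 'rV[R]_d}) (ties y q).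
have h2 := dadd (L :&: ties y q)%VS (V p).
have h3 : (\dim (L :&: ties y q + V p) <= \dim (ties y q))%N.
  by apply: dimvS; rewrite subv_add capvSr.
have h4 : (\dim (L + ties y q)%VS <= d)%N by rewrite -[X in (_ <= X)%N](dimv_rV R d) dimvS ?subvf.
rewrite Lk in h1 *.
move: Vk Vd dT cap0 h1 h2 h3 h4.
move: (\dim (V p)) (\dim (ties y q)) (\dim (L :&: ties y q)) (\dim (L + ties y q)%VS)
  (\dim (L :&: ties y q :&: V p)) (\dim (L :&: ties y q + V p)) (nblocks q).
by lia.
Unshelve. all: by end_near. Qed.

End GenericSubspace.

(** * Incidences of chambers, faces and subspaces *)

Section IndexedSums.
Variables (I : finType) (J : choiceType) (P : pred I) (f : I -> J).
Hypothesis fI : {in P &, injective f}.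
Let A := [set f i | i in [set i | P i]].

Lemma finite_indexed : finite_set A.
Proof. exact/finite_image/finite_finset. Qed.

Lemma perm_fset_set_indexed : perm_eq (fset_set A) (map f (enum P)).
Proof.
apply: uniq_perm; first exact: fset_uniq.
  by rewrite map_inj_in_uniq ?enum_uniq// => a b; rewrite !mem_enum; exact: fI.
move=> x; apply/idP/mapP.
  rewrite in_fset_set; last exact: finite_indexed.
  by rewrite inE => -[i /= Pi <-]; exists i; rewrite ?mem_enum.
move=> [i]; rewrite mem_enum => Pi ->; rewrite in_fset_set; last exact: finite_indexed.
by rewrite inE; exists i.
Qed.

Lemma fsum_indexed (R : realType) (F : J -> R) :
  \sum_(x \in A) F x = \sum_(i | P i) F (f i).
Proof.
rewrite fsbig_finite; last exact: finite_indexed.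
by rewrite (perm_big _ perm_fset_set_indexed) big_map big_enum.
Qed.

Lemma card_indexed : #|` fset_set A| = #|P|.
Proof. by rewrite (perm_size perm_fset_set_indexed) size_map -cardE. Qed.

End IndexedSums.

Section Incidences.
Variables (R : realType) (d n : nat) (y : 'I_n -> 'rV[R]_d).
Implicit Types (L : {vspace 'rV[R]_d}) (s : 'S_n).

Notation chamber s := (cone y (fun a => nat_of_ord (s a))).
Notation real V p := (realized V y (fun a => nat_of_ord (p a))).

Lemma cone_ord_eq N (p q : 'I_n -> 'I_N) : real fullv p -> real fullv q ->
  chamber p = chamber q -> forall a b, (p a <= p b)%N = (q a <= q b)%N.
Proof. by move=> [v _ pv] [w _ qw] /cone_eq; apply; [exists v|exists w]. Qed.

Lemma realizing_neq0 N (p : {ffun 'I_n -> 'I_N}) v : (1 < N)%N -> onto p ->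
  realizing y (fun a => p a) v -> v != 0.
Proof.
move=> N1 /ontoP po pv; have [a pa] := po (Ordinal (ltnW N1)).
have [b pb] := po (Ordinal N1); have := realizing_lt a b pv.
by rewrite pa pb /=; apply: contraTneq => ->; rewrite !inner0l ltxx.
Qed.

(** All the total orders refining a realized weak order are realized: around a
    face of the arrangement, the chambers are as many as the orders of the points
    inside the blocks. *)
Lemma refinement_real N (p : {ffun 'I_n -> 'I_N}) s : in_general_position fullv y ->
  (1 < N)%N -> onto p -> real fullv p -> refines s p -> real fullv s.
Proof.
move=> gp N1 po [v _ pv] /refinesP sp.
apply: realize_refinement gp (memvf v) (realizing_neq0 N1 po pv) _ => a b.
by move=> /sp; rewrite pv.
Qed.

(** In general position, a subspace meeting the cone of [p] outside of [0] also
    meets its relative interior, by [realize_refinement]. *)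
Lemma hits_coneP L N (p : {ffun 'I_n -> 'I_N}) : (1 < N)%N -> onto p ->
  in_general_position L y -> real fullv p ->
  hits (cone y (fun a => p a)) L <-> real L p.
Proof.
move=> N1 po gpL [w _ pw]; rewrite hitsP; last by move=> a b _; rewrite !inner0l.
split=> [[v [pv vL v0]]|[v vL pv]].
  exact: realize_refinement gpL vL v0 pv.
exists v; split => //; first exact: realizing_cone.
exact: realizing_neq0 N1 po pv.
Qed.

(** The labellings of the blocks of a partition that are induced by vectors of
    [L] are the orders induced on representatives of the blocks by the vectors
    of [L] constant on the blocks, a subspace of codimension [n - N] in [L]. *)
Lemma card_real_relabel L N (p : {ffun 'I_n -> 'I_N}) : (1 < N)%N -> onto p ->
  in_general_position L y ->
  #|[set r : 'S_N | `[< real L (relabel r p) >]]%SET| = DA N (\dim L - (n - N)).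
Proof.
move=> N1 /ontoP po gpL.
pose rep c := sval (cid (po c)).
have repK c : p (rep c) = c by rewrite /rep; case: cid.
have blocks (v : 'rV[R]_d) a : v \in ties y p -> inner v (y (rep (p a))) = inner v (y a).
  by move=> /tiesP; apply; rewrite repK.
have nb (T : eqType) (q : 'I_N -> T) : nblocks (q \o p) = nblocks q.
  apply/perm_size/uniq_perm; rewrite ?undup_uniq// => x; rewrite !mem_undup.
  by apply/codomP/codomP => [[a ->]|[c ->]]; [exists (p a)|exists (rep c); rewrite /= repK].
have dimV : \dim (L :&: ties y p) = (\dim L - (n - N))%N.
  by rewrite gp_dim// (nblocks_onto po).
have Nn : (N <= n)%N by rewrite -(nblocks_onto po) nblocks_le.
have gpV : in_general_position (L :&: ties y p) (y \o rep).
  move=> q; have -> : (L :&: ties y p :&: ties (y \o rep) q = L :&: ties y (q \o p))%VS.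
    apply/vspaceP => v; rewrite !memv_cap -andbA; congr (_ && _); apply/andP/tiesP.
      move=> [vp /tiesP vq] a b /= /vq; rewrite /= !blocks//.
    move=> vqp; have vp : v \in ties y p by apply/tiesP => a b ab; apply: vqp; rewrite /= ab.
    by split=> //; apply/tiesP => a b ab; apply: vqp; rewrite /= !repK.
  by rewrite gp_dim// nb dimV; have := nblocks_le q; lia.
rewrite -dimV -(card_realized N1 gpV); apply: eq_card => r; rewrite !inE.
apply: asbool_equiv_eq; split => [[v vL pv]|[v]].
  exists v; last by move=> a b; rewrite /= pv !ffunE !repK.
  rewrite memv_cap vL; apply/tiesP => a b ab; apply/eqP.
  by rewrite (realizing_eq _ _ pv) !ffunE ab.
rewrite memv_cap => /andP[vL vp] rv; exists v => // a b.
by rewrite !ffunE -rv /= !blocks.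
Qed.

Lemma card_incidences L N (X : pred ('S_n * {ffun 'I_n -> 'I_N})) : (1 < N)%N -> (0 < n)%N ->
  in_general_position L y ->
  (forall s p, X (s, p) <-> [/\ onto p, refines s p & real L p]) ->
  (N`! * #|X| = n`! * 'C(n.-1, N.-1) * DA N (\dim L - (n - N)))%N.
Proof.
move=> N1 n0 gpL XP.
rewrite -(card_good_pairs (good := fun p => `[< real L p >]) n0 (ltnW N1)); last first.
  by move=> p po; exact: card_real_relabel.
congr (_ * _)%N; rewrite -sum1_card.
rewrite (eq_bigl (fun sp => (onto sp.2 && `[< real L sp.2 >]) && refines sp.1 sp.2)); last first.
  move=> [s p]; rewrite unfold_in; apply/idP/andP => [/XP[po sp pL]|[/andP[po /asboolP pL] sp]].
    by rewrite po; split=> //; apply/asboolP.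
  by apply/XP.
transitivity (\sum_(p : {ffun 'I_n -> 'I_N} | onto p && `[< real L p >]) \sum_(s | refines s p) 1)%N.
  by rewrite (exchange_big_dep xpredT)//= pair_big_dep.
by apply: eq_bigr => p _; rewrite sum1dep_card.
Qed.

End Incidences.

(** * The mean size functional *)

Section MeanSize.
Variables (R : realType) (d n : nat) (nu : nat -> probability (subspaces R d) R).
Hypothesis hnu : forall m, (m <= d)%N -> grassmann_measure m (nu m).

Lemma quermassintegralE k C : (k <= d)%N -> measurable (hits C) ->
  quermassintegral nu (d - k) C = 2^-1 * fine (nu k (hits C `&` @grassmannian R d k)).
Proof.
move=> kd mC; rewrite /quermassintegral subKn//; congr (_ * _).
by rewrite /Rintegral integral_indic//; exact: measurable_grassmannian.
Qed.

(** The mean is a sum of probabilities of incidence between a face of a chamber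
    and the random subspace.  Their sum is the expected number of incidences,
    and this number does not depend on the subspace in general position. *)
Lemma mean_size_functional (y : 'I_n -> 'rV[R]_d) j k :
  typeA_general_position y -> (1 <= j)%N -> (j <= k)%N -> (k <= d)%N ->
  uniform_mean (weyl_tessellation y) (size_functional nu (d - k + j) (d - k)) =
  ('C(n - 1, k - j) * DA (n - k + j) j)%:R / (2 * DA n d)%:R
    * (n`!%:R / (n - k + j)`!%:R).
Proof.
move=> gpA j1 jk kd; have [dn _] := gpA; have gp := typeA_in_general_position gpA.
pose m := (k - j)%N; pose N := (n - m)%N.
have -> : (n - k + j = N)%N by rewrite /N /m; lia.
have -> : (d - k + j = d - m)%N by rewrite /m; lia.
have N1 : (1 < N)%N by rewrite /N /m; lia.
have n1 : (1 < n)%N by lia.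
pose S := [pred s : 'S_n | `[< realized fullv y (fun a => s a) >]].
have WE : weyl_tessellation y = [set cone y (fun a => s a) | s in [set s : 'S_n | S s]].
  rewrite weyl_tessellationE; congr (_ @` _); apply/seteqP.
  by split => s /= h; apply/asboolP.
have SI : {in S &, injective (fun s : 'S_n => cone y (fun a => s a))}.
  move=> s t /asboolP sr /asboolP tr st; apply: perm_order_inj.
  exact: (cone_ord_eq (p := s) (q := t) sr tr st).
have cS : #|S| = DA n d.
  rewrite -[d in RHS](dimv_rV R d) -(card_realized n1 gp); apply: eq_card => s.
  by rewrite !inE.
pose FS s := [pred p : {ffun 'I_n -> 'I_N} | [&& onto p, refines s p & `[< realized fullv y (fun a => p a) >]]].
pose A (sp : 'S_n * {ffun 'I_n -> 'I_N}) := hits (cone y (fun a => sp.2 a)) `&` @grassmannian R d k.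
have mH (p : {ffun 'I_n -> 'I_N}) : measurable (hits (cone y (fun a => p a))).
  by apply: measurable_hits; exact: cone_closed_cone.
have mA sp : measurable (A sp) by apply: measurableI => //; exact: measurable_grassmannian.
have sizeE s : S s -> size_functional nu (d - m) (d - k) (cone y (fun a => s a)) =
    \sum_(p | FS s p) 2^-1 * fine (nu k (A (s, p))).
  move=> /asboolP sr; rewrite /size_functional (faces_chamberE gp)//; last by rewrite /m; lia.
  have -> : [set p : {ffun 'I_n -> 'I_N} | [/\ onto p, refines s p & realized fullv y (fun a => p a)]]
      = [set p | FS s p].
    apply/seteqP; split => p /=; first by move=> [-> -> pr]; apply/asboolP.
    by move=> /and3P[-> -> /asboolP].
  rewrite (fsum_indexed (f := fun p : {ffun 'I_n -> 'I_N} => cone y (fun a => p a))).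
    by apply: eq_bigr => p _; rewrite quermassintegralE.
  move=> p q /and3P[/ontoP po _ /asboolP pr] /and3P[/ontoP qo _ /asboolP qr] pq.
  by apply/ffunP; apply: onto_order_inj => //; exact: (cone_ord_eq pr qr pq).
rewrite /uniform_mean WE (card_indexed SI) cS (fsum_indexed SI).
rewrite (eq_bigr _ sizeE) pair_big_dep /= -mulr_sumr.
pose c : R := (n`! * 'C(n.-1, N.-1) * DA N j)%:R / N`!%:R.
have N0 : (N`!%:R : R) != 0 by rewrite pnatr_eq0 -lt0n fact_gt0.
have nuA : (\sum_(sp | S sp.1 && FS sp.1 sp.2) nu k (A sp) = c%:E)%E.
  rewrite -big_filter; apply: sum_probability_eq => //.
  have := ae_general_position (hnu kd) kd gp.
  apply: (@filterS _ _ (ae_filter_ringOfSetsType (nu k))) => L [Lk gpL].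
  pose X := [pred sp | (S sp.1 && FS sp.1 sp.2) && `[< A sp L >]].
  have -> : count (fun sp => `[< A sp L >]) [seq sp <- index_enum _ | S sp.1 && FS sp.1 sp.2] = #|X|.
    by rewrite -sum1_count big_filter_cond -sum1_card; apply: eq_bigl.
  apply: (mulfI N0); rewrite [RHS]mulrC divfK// -natrM; congr _%:R.
  have -> : j = (\dim (L : {vspace 'rV[R]_d}) - (n - N))%N by rewrite Lk /N /m; lia.
  apply: (card_incidences (N := N)) => //; first by lia.
  move=> s p; rewrite /X /=; split.
    move=> /andP[/andP[_ /and3P[po sp /asboolP pr]] /asboolP[hL _]].
    by split=> //; apply/(hits_coneP N1 po gpL pr).
  move=> [po sp pL]; have pr : realized fullv y (fun a => p a).
    by case: pL => v _ pv; exists v; rewrite ?memvf.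
  rewrite po sp /=; apply/andP; split; last first.
    by apply/asboolP; split => //; apply/(hits_coneP N1 po gpL pr).
  by apply/andP; split; apply/asboolP => //; exact: (refinement_real gp N1 po pr).
have -> : \sum_(sp | S sp.1 && FS sp.1 sp.2) fine (nu k (A sp)) = c.
  apply: EFin_inj; rewrite -nuA -sumEFin; apply: eq_bigr => sp _.
  by rewrite fineK// fin_num_measure.
have -> : 'C(n - 1, k - j) = 'C(n.-1, N.-1).
  by rewrite subn1 -bin_sub; [congr 'C(_, _)|]; rewrite /N /m; lia.
rewrite /c; move: (DA n d) (DA N j) => Dn Dj; rewrite !natrM.
have [->|D0] := eqVneq Dn 0%N; first by rewrite mulr0 invr0 !(mul0r, mulr0).
have D0' : (Dn%:R : R) != 0 by rewrite pnatr_eq0.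
by field; rewrite N0 D0'.
Qed.

Lemma mean_size_functional_ge0 (y : 'I_n -> 'rV[R]_d) k j :
  0 <= uniform_mean (weyl_tessellation y) (size_functional nu k j).
Proof.
rewrite mulr_ge0 ?invr_ge0//; apply: fsumr_ge0 => C _; apply: fsumr_ge0 => F _.
by rewrite mulr_ge0 ?invr_ge0// /Rintegral fine_ge0// integral_ge0.
Qed.

End MeanSize.

Theorem theorem1p6 (R : realType) (d n : nat) (hd : (2 <= d)%N)
    (nu : nat -> probability (subspaces R d) R)
    (hnu : forall m : nat, (m <= d)%N -> grassmann_measure m (nu m))
    (dsp : measure_display) (Omega : measurableType dsp)
    (P : probability Omega R) (Y : 'I_n -> Omega -> 'rV[R]_d)
    (hYm : forall (i : 'I_n) (c : 'I_d),
        measurable_fun [set: Omega] (fun w => Y i w 0 c))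
    (hYgp : {ae P, forall w, typeA_general_position (fun i => Y i w)})
    (j k : nat) (hj : (1 <= j)%N) (hjk : (j <= k)%N) (hkd : (k <= d)%N) :
  weyl_cone_expectation P Y (size_functional nu (d - k + j) (d - k)) =
  ((('C(n - 1, k - j) * DA (n - k + j) j)%:R / (2 * DA n d)%:R
    * (n`!%:R / (n - k + j)`!%:R)) : R)%:E.
Proof.
apply: expectation_ae_cst.
- by rewrite mulr_ge0// divr_ge0.
- by move=> w; exact: mean_size_functional_ge0.
- by apply: filterS hYgp => w gpw; exact: mean_size_functional.
Qed.
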